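(* Let $a,b,c,d,f$ be positive integers such that $a+b+c+d+f$ is even or $a+b+c+d+f\le 10$. Then $\zeta_{\mathfrak{sl}(4)}(a,b,c,d,0,f)$ can be expressed as a (finite) linear combination with rational coefficients of products of single and double Euler sums.
   Context: The Witten multiple zeta-function associated with $\mathfrak{sl}(4)$ is $$\zeta_{\mathfrak{sl}(4)}(t_1,t_2,t_3,t_4,t_5,t_6)=\sum_{m_1,m_2,m_3=1}^{\infty}\frac{1}{m_1^{t_1}m_2^{t_2}m_3^{t_3}(m_1+m_2)^{t_4}(m_2+m_3)^{t_5}(m_1+m_2+m_3)^{t_6}},$$ so that $$\zeta_{\mathfrak{sl}(4)}(a,b,c,d,0,f)=\sum_{m_1,m_2,m_3=1}^{\infty}\frac{1}{m_1^{a}m_2^{b}m_3^{c}(m_1+m_2)^{d}(m_1+m_2+m_3)^{f}}.$$ The Euler sum of depth $r$ is $$\zeta(s_1,\dots,s_r)=\sum_{n_1>\cdots>n_r>0}\ \prod_{j=1}^r n_j^{-s_j},$$ taken here at positive integers $s_1,\dots,s_r$ with $s_1\ge 2$ (so that the series converges). Single and double Euler sums are the Euler sums of depth $r=1$ and $r=2$ respectively. A product may consist of a single factor. *)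

(* Defs.v *)
From HB Require Import structures.
From mathcomp Require Import all_boot all_order all_algebra.
From mathcomp Require Import all_classical all_reals all_analysis.

Set Implicit Arguments.
Unset Strict Implicit.
Unset Printing Implicit Defensive.

Import Order.TTheory GRing.Theory Num.Theory.

Local Open Scope classical_set_scope.
Local Open Scope ring_scope.

(* All series have nonnegative terms, so they are unordered sums in [0, +oo];
   an equation [_ = x%:E] with [x : R] includes convergence. *)

Definition zeta_sl4 (R : realType) (t1 t2 t3 t4 t5 t6 : nat) : \bar R :=
  \esum_(m in [set m : nat * nat * nat |
                 [/\ (0 < m.1.1)%N, (0 < m.1.2)%N & (0 < m.2)%N]])
    (let: (m1, m2, m3) := m in
     (m1%:R ^+ t1 * m2%:R ^+ t2 * m3%:R ^+ t3 * (m1 + m2)%N%:R ^+ t4 *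
      (m2 + m3)%N%:R ^+ t5 * (m1 + m2 + m3)%N%:R ^+ t6)^-1)%:E.

Definition euler_sum (R : realType) (r : nat) (s : r.-tuple nat) : \bar R :=
  \esum_(n in [set n : r.-tuple nat | sorted gtn n && all (ltn 0%N) n])
    (\prod_(j < r) (tnth n j)%:R ^- tnth s j)%:E.

(* Forces r > 0, since [head 0 [::] = 0]. *)
Definition admissible (r : nat) (s : r.-tuple nat) : bool :=
  all (ltn 0%N) s && (2 <= head 0%N s)%N.

Definition euler_sums_of_depth (R : realType) (r : nat) : set R :=
  [set x | exists2 s : r.-tuple nat, admissible s & euler_sum R s = x%:E].

Arguments euler_sums_of_depth : clear implicits.

Definition finite_products (R : realType) (A : set R) : set R :=
  [set x | exists xs : seq R,
     [/\ xs != [::], {in xs, forall y, A y} & x = \prod_(y <- xs) y]].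

Definition rat_combinations (R : realType) (A : set R) : set R :=
  [set x | exists l : seq (rat * R),
     {in l, forall qy, A qy.2} /\ x = \sum_(qy <- l) ratr qy.1 * qy.2].

(* Main.v *)
(* Partial fractions turn the truncation of the sum at m1 + m2 + m3 <= N into a
   sum of truncated triple Euler sums T_N(f, d, a) of the same weight, with
   f >= 2. Let H_N be the harmonic numbers. Call a sequence regular if it equals
   p(H_N) up to an error smaller than every power of 1 / log N, where p(0) lies
   in the rational algebra spanned by single and double Euler sums. Regular
   sequences form an algebra containing all truncated single and double sums,
   and a convergent regular sequence has its limit in the algebra, so it
   suffices that triple sums are regular; working with truncations makes the
   divergent sums harmless.

   Put f(x, y, z) = sum of x^i y^j z^k T_N(i + 1, j + 1, k + 1) over
   i + j + k = d. Modulo regular sequences, the two ways of expanding a product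
   of a single and a double sum give
     f(x, y, z) + f(y, x, z) + f(y, z, x) = 0                    (stuffle),
     f(x + y, y, z) + f(x + y, x + z, x) + f(x + y, x + z, z) = 0  (shuffle).
   Together they imply f(x, y, z) = f(-x, -y, -z), hence f = 0 for d odd, i.e.
   for even weight d + 3. In weights 5, 7 and 9 the relations at sample points
   form a linear system of full rank in the unknowns T_N. *)
Require Import Defs.
From Stdlib Require Import BinInt.
From mathcomp Require Import all_boot all_order all_algebra.
From mathcomp Require Import all_classical all_reals all_analysis.
From mathcomp Require Import finmap ring lra zify ssrZ.

Set Implicit Arguments.
Unset Strict Implicit.
Unset Printing Implicit Defensive.

Import Order.TTheory GRing.Theory Num.Theory.
Import numFieldNormedType.Exports.

Local Open Scope classical_set_scope.
Local Open Scope ring_scope.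

(** * Closure properties of rational combinations and of finite products *)

Section RatCombinations.
Variable R : realType.
Implicit Types (A : set R) (x y : R).

Lemma rat_combinations0 A : rat_combinations A 0.
Proof. by exists [::]; rewrite big_nil; split. Qed.

Lemma rat_combinations_sub A x : A x -> rat_combinations A x.
Proof.
move=> Ax; exists [:: (1, x)]; rewrite big_seq1 rmorph1 mul1r; split=> // qy.
by rewrite inE => /eqP ->.
Qed.

Lemma rat_combinationsD A x y :
  rat_combinations A x -> rat_combinations A y -> rat_combinations A (x + y).
Proof.
move=> [l [lA ->]] [m [mA ->]]; exists (l ++ m); rewrite big_cat; split=> // qy.
by rewrite mem_cat => /orP[/lA|/mA].
Qed.

Lemma rat_combinationsZ A (q : rat) x :
  rat_combinations A x -> rat_combinations A (ratr q * x).
Proof.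
move=> [l [lA ->]]; exists [seq (q * qy.1, qy.2) | qy <- l]; split.
  by move=> _ /mapP[qy /lA Aqy ->].
by rewrite big_map big_distrr; apply: eq_bigr => qy _; rewrite rmorphM /= mulrA.
Qed.

Lemma rat_combinationsM A x y : (forall x y, A x -> A y -> A (x * y)) ->
  rat_combinations A x -> rat_combinations A y -> rat_combinations A (x * y).
Proof.
move=> AM [l [lA ->]] Ay; rewrite big_distrl big_seq /=.
apply: big_ind => [|u v|qx /lA Aqx]; [exact: rat_combinations0|exact: rat_combinationsD|].
 rewrite -mulrA; apply: rat_combinationsZ.
case: Ay => m [mA ->]; rewrite big_distrr big_seq /=.
apply: big_ind => [|u v|qy /mA Aqy]; [exact: rat_combinations0|exact: rat_combinationsD|].
 rewrite mulrCA; apply: rat_combinationsZ.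
by apply: rat_combinations_sub; apply: AM.
Qed.

Lemma finite_products_sub A x : A x -> finite_products A x.
Proof.
move=> Ax; exists [:: x]; rewrite big_seq1; split=> // y.
by rewrite inE => /eqP ->.
Qed.

Lemma finite_productsM A x y :
  finite_products A x -> finite_products A y -> finite_products A (x * y).
Proof.
move=> [xs [xs0 xsA ->]] [ys [_ ysA ->]]; exists (xs ++ ys).
rewrite big_cat; split=> // [|z]; first by case: (xs) xs0.
by rewrite mem_cat => /orP[/xsA|/ysA].
Qed.

End RatCombinations.

(** * Sequences up to rapidly decreasing errors *)

Section Sequences.
Variable R : realType.
Implicit Types (u v : nat -> R) (k N : nat).

(* The sum over [N >= n_1 > ... > n_r >= 1], with indices shifted by one. *)
Fixpoint mhs (s : seq nat) (N : nat) : R :=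
  if s is a :: s' then \sum_(n < N) n.+1%:R ^- a * mhs s' n else 1.

Definition harm := mhs [:: 1%N].
(* Plays the role of [log N], but is at least [1]. *)
Definition lg N := 1 + harm N.

Lemma mhsS a s N : mhs (a :: s) N.+1 = mhs (a :: s) N + N.+1%:R ^- a * mhs s N.
Proof. by rewrite /= big_ord_recr. Qed.

Lemma mhs_ge0 s N : 0 <= mhs s N.
Proof.
elim: s N => [|a s IH] N //=; apply: sumr_ge0 => n _.
by rewrite mulr_ge0 ?invr_ge0 ?exprn_ge0.
Qed.

Lemma harmS N : harm N.+1 = harm N + N.+1%:R^-1.
Proof. by rewrite /harm mhsS /= mulr1. Qed.

Lemma lgS N : lg N.+1 = lg N + N.+1%:R^-1.
Proof. by rewrite /lg harmS addrA. Qed.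

Lemma lg_ge1 N : 1 <= lg N.
Proof. by rewrite lerDl mhs_ge0. Qed.

Lemma lg_gt0 N : 0 < lg N.
Proof. exact: lt_le_trans ltr01 (lg_ge1 N). Qed.

Lemma lg_ndecr m n : (m <= n)%N -> lg m <= lg n.
Proof.
move=> /subnKC <-; elim: (n - m)%N => [|j IH]; rewrite ?addn0 // addnS lgS.
by rewrite (le_trans IH) // lerDl invr_ge0.
Qed.

Lemma harm_le_lg N : harm N <= lg N.
Proof. by rewrite lerDr. Qed.

Lemma lg_unbounded (C : R) : exists N, C < lg N.
Proof.
have [//|bC] := pselect (exists N, C < lg N); exfalso.
apply: (@dvg_harmonic R); apply: nondecreasing_is_cvgn.
  by apply: nondecreasing_series => n _ _; exact: harmonic_ge0.
exists C => _ [N _ <-]; rewrite leNgt; apply/negP => CN; apply: bC; exists N.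
apply: lt_le_trans CN _; rewrite /series /= big_mkord.
rewrite -[leLHS](_ : harm N = _) ?harm_le_lg //.
by apply: eq_bigr => n _; rewrite mulr1.
Qed.

(** Since d <= 1 <= x, the higher powers of d are absorbed into the linear term. This controls how
    much a power of [lg] grows in one step. *)
Lemma expr_incr k : exists2 C : R, 0 <= C &
  forall x d : R, 1 <= x -> 0 <= d <= 1 -> (x + d) ^+ k.+1 <= x ^+ k.+1 + C * x ^+ k * d.
Proof.
elim: k => [|k [C C0 IH]]; first by exists 1 => // x d _ _; rewrite !expr1 expr0; lra.
exists (1 + 2 * C) => [|x d x1 /andP[d0 d1]]; first lra.
rewrite exprS; have xd0 : 0 <= x + d by lra.
have /(ler_wpM2l xd0) := IH x d x1 (introT andP (conj d0 d1)).
move=> /le_trans; apply; rewrite [x ^+ k.+2]exprS [x ^+ k.+1]exprS.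
have xk : 0 <= x ^+ k by rewrite exprn_ge0; lra.
have h1 : 0 <= C * x ^+ k * d * (x - d) by rewrite !mulr_ge0 //; lra.
move: h1; move: (x ^+ k) => y h1.
have -> : (x + d) * (x * y + C * y * d) =
  x * (x * y) + (1 + 2 * C) * (x * y) * d - C * y * d * (x - d) by ring.
by lra.
Qed.

Lemma invS_itv N : 0 <= (N.+1%:R^-1 : R) <= 1.
Proof. by rewrite invr_ge0 ler0n invf_le1 ?ltr0n // ler1n. Qed.

(** By [expr_incr] one step adds at most D lg^k / (N + 1) to lg^(k+1), and the bound for k turns
    this into a constant; so the growth is at most linear. *)
Lemma lgX_le k : exists C : R, forall N, lg N ^+ k <= C * N.+1%:R.
Proof.
elim: k => [|k [C IH]].
  by exists 1 => N; rewrite expr0 mul1r ler1n.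
have [D D0 HD] := expr_incr k.
exists (1 + D * C) => N; elim: N => [|N IHN].
  have := IH 0%N; rewrite /lg /harm /= big_ord0 addr0 !expr1n !mulr1 => C1.
  by rewrite lerDl; nra.
rewrite lgS; apply: le_trans (HD _ _ (lg_ge1 N) (invS_itv N)) _.
have -> : N.+2%:R = N.+1%:R + 1 :> R by rewrite -addn1 natrD.
rewrite mulrDr mulr1; apply: lerD => //.
apply: (@le_trans _ _ (D * C)); last by rewrite lerDr.
rewrite -mulrA ler_wpM2l // ler_pdivrMr ?ltr0n //.
Qed.

Definition logsmall u := forall k, exists C, forall N, `|u N| * lg N ^+ k <= C.

Definition polylog u := exists k, exists C, forall N, `|u N| <= C * lg N ^+ k.

Lemma logsmall_le u v :
  (forall N, `|u N| <= `|v N|) -> logsmall v -> logsmall u.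
Proof.
move=> uv nv k; have [C HC] := nv k; exists C => N; apply: le_trans (HC N).
by rewrite ler_wpM2r // exprn_ge0 // ltW // lg_gt0.
Qed.

Lemma eq_logsmall u v : u =1 v -> logsmall u -> logsmall v.
Proof. by move=> uv; apply: logsmall_le => N; rewrite uv. Qed.

Lemma logsmall0 : logsmall (fun=> 0).
Proof. by move=> k; exists 0 => N; rewrite normr0 mul0r. Qed.

Lemma logsmallD u v :
  logsmall u -> logsmall v -> logsmall (fun N => u N + v N).
Proof.
move=> nu nv k; have [[C HC] [D HD]] := (nu k, nv k); exists (C + D) => N.
apply: le_trans (lerD (HC N) (HD N)); rewrite -mulrDl ler_wpM2r ?ler_normD //.
by rewrite exprn_ge0 // ltW // lg_gt0.
Qed.

Lemma logsmallM u v :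
  polylog u -> logsmall v -> logsmall (fun N => u N * v N).
Proof.
move=> [j [C HC]] nv k; have [D HD] := nv (k + j)%N; exists (C * D) => N.
have C0 : 0 <= C.
  have := HC N; have := exprn_gt0 j (lg_gt0 N); have := normr_ge0 (u N); nra.
rewrite normrM; apply: (@le_trans _ _ (C * (`|v N| * lg N ^+ (k + j)))).
  rewrite exprD; have := HC N; have := normr_ge0 (v N).
  have := exprn_gt0 k (lg_gt0 N).
  move: (lg N ^+ k) (lg N ^+ j) `|v N| `|u N| => x y z t x0 z0 H.
  have : 0 <= (C * y - t) * (z * x) by rewrite mulr_ge0 ?subr_ge0 // mulr_ge0 // ltW.
  lra.
by rewrite ler_wpM2l.
Qed.

Lemma polylog_cst (c : R) : polylog (fun=> c).
Proof. by exists 0%N, `|c| => N; rewrite expr0 mulr1. Qed.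

Lemma polylog_weaken u k (C : R) j : (forall N, `|u N| <= C * lg N ^+ k) ->
  forall N, `|u N| <= C * lg N ^+ (k + j).
Proof.
move=> HC N; apply: le_trans (HC N) _.
have C0 : 0 <= C.
  have := HC N; have := exprn_gt0 k (lg_gt0 N); have := normr_ge0 (u N); nra.
by rewrite ler_wpM2l // ler_weXn2l ?lg_ge1 // leq_addr.
Qed.

Lemma polylogD u v : polylog u -> polylog v -> polylog (fun N => u N + v N).
Proof.
move=> [j [C HC]] [k [D HD]]; exists (j + k)%N, (C + D) => N.
rewrite mulrDl; apply: le_trans (ler_normD _ _) (lerD _ _).
  exact: polylog_weaken.
by rewrite addnC; exact: polylog_weaken.
Qed.

Lemma polylogM u v : polylog u -> polylog v -> polylog (fun N => u N * v N).
Proof.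
move=> [j [C HC]] [k [D HD]]; exists (j + k)%N, (C * D) => N.
by rewrite normrM exprD mulrACA ler_pM.
Qed.

Lemma polylog_harm : polylog harm.
Proof. by exists 1%N, 1 => N; rewrite expr1 mul1r ger0_norm ?mhs_ge0 // harm_le_lg. Qed.

Lemma polylog_horner (p : {poly R}) : polylog (fun N => p.[harm N]).
Proof.
elim/poly_ind: p => [|p c IH].
  by have [k [C HC]] := polylog_cst 0; exists k, C => N; rewrite horner0.
have [k [C HC]] := polylogD (polylogM IH polylog_harm) (polylog_cst c).
by exists k, C => N; rewrite hornerMXaddC.
Qed.

Lemma logsmall_polylog u : logsmall u -> polylog u.
Proof. by move=> /(_ 0%N)[C HC]; exists 0%N, C => N; have := HC N; rewrite !expr0 !mulr1. Qed.

(** [lgX_le] absorbs the numerator together with any further power of [lg]. Truncation errors and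
    corner sums are later compared with this form. *)
Lemma logsmall_lg_over k (C : R) : logsmall (fun N => C * (lg N ^+ k / N.+1%:R)).
Proof.
apply: logsmallM; first exact: polylog_cst.
move=> j; have [D HD] := lgX_le (k + j); exists D => N.
rewrite ger0_norm; last by rewrite divr_ge0 // exprn_ge0 // ltW // lg_gt0.
by rewrite mulrAC -exprD ler_pdivrMr ?ltr0n.
Qed.

Lemma logsmall_cvg0 u : logsmall u -> u @ \oo --> (0 : R).
Proof.
move=> /(_ 1%N)[C HC]; apply/cvgrPdist_lt => e e0.
have [M HM] := lg_unbounded (C / e); exists M => // N /= MN.
rewrite sub0r normrN; have := HC N; rewrite expr1 => HN.
have : C < e * lg N.
  by rewrite mulrC -ltr_pdivrMr //; apply: lt_le_trans HM (lg_ndecr _).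
by move=> /(le_lt_trans HN); rewrite ltr_pM2r // lg_gt0.
Qed.

(* If [q(harm N)] tends to [0], so does [(q(harm N) - q(0)) / harm N]: the
   coefficients of [q] vanish one after the other. *)
Lemma horner_harm_cvg0 (q : {poly R}) : q.[harm N] @[N --> \oo] --> (0 : R) -> q = 0.
Proof.
elim/poly_ind: q => [//|q c IH] qc0.
have q0 : q = 0.
  apply: IH; apply/cvgrPdist_lt => e e0.
  move/cvgrPdist_lt : qc0 => /(_ 1 ltr01)[M _ HM].
  (* From [M] on the polynomial value is below 1; from [K] on [harm N] exceeds (1 + |c|) / e, the
     extra 1 making up for the shift in [lg]. *)
  have [K HK] := lg_unbounded (1 + (1 + `|c|) / e).
  exists (M + K)%N => // N /= MKN; rewrite sub0r normrN.
  have := HM N (leq_trans (leq_addr _ _) MKN); rewrite sub0r normrN hornerMXaddC => H1.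
  have h0 : 0 < harm N.
    have := lt_le_trans HK (lg_ndecr (leq_trans (leq_addl _ _) MKN)).
    by rewrite ltrD2l; apply: le_lt_trans; rewrite divr_ge0 // ?addr_ge0 // ltW.
  have H2 : (1 + `|c|) < e * harm N.
    rewrite mulrC -ltr_pdivrMr //.
    by have := lt_le_trans HK (lg_ndecr (leq_trans (leq_addl _ _) MKN)); rewrite ltrD2l.
  rewrite -(ltr_pM2r h0); apply: le_lt_trans H2.
  rewrite -[X in _ * X](gtr0_norm h0) -normrM.
  have -> : q.[harm N] * harm N = (q.[harm N] * harm N + c) - c by rewrite addrK.
  by apply: le_trans (ler_normB _ _) _; rewrite lerD2r ltW.
move: qc0; rewrite q0 mul0r add0r => c0.
have -> : c = 0; last by rewrite polyC0.
apply: (cvg_unique _ _ c0) => //; rewrite (_ : (fun N => _) = fun=> c).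
  exact: cvg_cst.
by apply/funext => N; rewrite hornerC.
Qed.

End Sequences.

(** * Convergence of truncated sums, with a rate *)

Section Convergence.
Variable R : realType.
Implicit Types (u v : nat -> R) (k N : nat) (s : seq nat).
Local Notation lg := (lg R).
Local Notation mhs := (mhs R).
Local Notation harm := (harm R).

(** [v] majorizes the tails of the series of lg^k / (N + 1)^2, by Abel summation. The decrease of 2
    lg^(k+1) / (N + 1) covers the term for k + 1 up to an error of order lg^k / (N + 1)^2, which a
    multiple of the [v] for k pays for. The factor 2 serves for 2 / (n (n + 1)) >= 1 / n^2. *)
Lemma lg_tail k : exists (v : nat -> R) (C : R), forall N,
  [/\ 0 <= v N, v N <= C * (lg N ^+ k / N.+1%:R) &
      lg N ^+ k / N.+1%:R ^+ 2 <= v N - v N.+1].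
Proof.
have SS N : N.+2%:R = N.+1%:R + 1 :> R by rewrite -addn1 natrD.
have S1 N : 1 <= N.+1%:R :> R by rewrite ler1n.
elim: k => [|k [v [C Hv]]].
  exists (fun N => 2 / N.+1%:R), 2 => N; split; first by rewrite divr_ge0.
    by rewrite expr0 div1r.
  rewrite /= expr0 (SS N); have := S1 N; move: (N.+1%:R) => n n1.
  rewrite -subr_ge0 (_ : _ - _ = (n - 1) / (n ^+ 2 * (n + 1))).
    by rewrite divr_ge0 ?mulr_ge0 ?exprn_ge0 //; lra.
  by field; apply/andP; split; lra.
have [D D0 HD] := expr_incr R k.
exists (fun N => 2 * (lg N ^+ k.+1 / N.+1%:R) + 2 * D * v N), (2 + 2 * D * C) => N.
have [v0 vC vS] := Hv N; have L1 := lg_ge1 R N.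
have Lk : 0 <= lg N ^+ k by rewrite exprn_ge0 // (le_trans ler01).
have n0 : 0 < N.+1%:R :> R by rewrite ltr0n.
have C0 : 0 <= C * (lg N ^+ k / N.+1%:R) := le_trans v0 vC.
split; cbv beta.
- by rewrite addr_ge0 // !mulr_ge0 // ?invr_ge0 // ?exprn_ge0 //; lra.
- rewrite -subr_ge0 exprS (_ : _ - _ = 2 * D * (C * (lg N ^+ k / N.+1%:R) - v N)
      + 2 * D * ((lg N - 1) * (C * (lg N ^+ k / N.+1%:R)))); last by ring.
  apply: addr_ge0; apply: mulr_ge0; rewrite ?subr_ge0 //; first exact: mulr_ge0.
    exact: mulr_ge0.
  by apply: mulr_ge0; rewrite ?subr_ge0.
have := HD _ _ L1 (invS_itv R N); rewrite -lgS => incr.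
have E : 2 * (lg N.+1 ^+ k.+1 / N.+2%:R) <=
         2 * ((lg N ^+ k.+1 + D * lg N ^+ k * N.+1%:R^-1) / N.+2%:R).
  by rewrite ler_wpM2l // ler_wpM2r // invr_ge0.
have aux (a b c e f g x : R) :
  a <= b -> g <= e - f -> x <= c - b + g -> x <= c + e - (a + f) by lra.
apply: (aux _ _ _ _ _ (2 * D * (lg N ^+ k / N.+1%:R ^+ 2)) _ E).
  by rewrite -mulrBr ler_wpM2l // mulr_ge0.
rewrite (SS N) exprS; move: (S1 N) Lk L1; move: (lg N ^+ k) (N.+1%:R) => y n.
move: (lg N) => L n1 y0 L1; rewrite -subr_ge0.
rewrite (_ : _ - _ = (L * y * (n - 1) + 2 * D * y) / (n ^+ 2 * (n + 1))).
  have [n0' m0] : 0 <= n /\ 0 <= n - 1 by lra.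
  have L0 : 0 <= L by lra.
  have Ly : 0 <= L * y * (n - 1) by rewrite !mulr_ge0.
  have Dy : 0 <= 2 * D * y by rewrite !mulr_ge0.
  by apply: divr_ge0; [exact: addr_ge0|rewrite mulr_ge0 ?exprn_ge0 ?addr_ge0].
by field; apply/andP; split; lra.
Qed.

(** With [v] from [lg_tail], u - C v increases and u + C v decreases. They squeeze [u] to a common
    limit, and C v bounds the distance to it. *)
Lemma cvg_of_lg_increments u k (C : R) :
  (forall N, `|u N.+1 - u N| <= C * (lg N ^+ k / N.+1%:R ^+ 2)) ->
  exists l : R, u @ \oo --> l /\
    exists D, forall N, `|u N - l| <= D * (lg N ^+ k / N.+1%:R).
Proof.
move=> Hu; have [v [D Hv]] := lg_tail k.
have C0 : 0 <= C.
  have x0 : 0 < lg 0 ^+ k / 1%:R ^+ 2 by rewrite expr1n divr1 exprn_gt0 // lg_gt0.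
  by rewrite -(pmulr_lge0 _ x0); exact: le_trans (normr_ge0 _) (Hu 0%N).
have Cv N : `|u N.+1 - u N| <= C * v N - C * v N.+1.
  apply: le_trans (Hu N) _; rewrite -mulrBr ler_wpM2l //.
  by have [] := Hv N.
have v0 N : 0 <= C * v N by rewrite mulr_ge0 //; have [] := Hv N.
have vD N : C * v N <= C * D * (lg N ^+ k / N.+1%:R).
  by rewrite -mulrA ler_wpM2l //; have [] := Hv N.
have cv0 : (fun N => C * v N) @ \oo --> (0 : R).
  apply: logsmall_cvg0; apply: logsmall_le (logsmall_lg_over k (C * D)) => N.
  by rewrite !ger0_norm // (le_trans _ (vD N)).
pose lo N := u N - C * v N; pose hi N := u N + C * v N.
have lo_nd : nondecreasing_seq lo.
  apply/nondecreasing_seqP => N; have := Cv N; rewrite /lo ler_norml => /andP[].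
  by lra.
have hi_ni : nonincreasing_seq hi.
  apply/nonincreasing_seqP => N; have := Cv N; rewrite /hi ler_norml => /andP[].
  by lra.
have lohi m n : lo m <= hi n.
  apply: le_trans (lo_nd _ _ (leq_maxl m n)) _.
  apply: le_trans _ (hi_ni _ _ (leq_maxr m n)).
  by rewrite /lo /hi; have := v0 (maxn m n); lra.
have lo_cvg : lo @ \oo --> limn lo.
  apply: nondecreasing_is_cvgn => //; exists (hi 0%N) => _ [N _ <-]; exact: lohi.
exists (limn lo); split.
  rewrite -[limn lo]addr0; rewrite (_ : u = fun N => lo N + C * v N).
    exact: cvgD.
  by apply/funext => N; rewrite /lo subrK.
exists (C * D) => N; apply: le_trans (vD N); rewrite ler_distl.
have h1 : lo N <= limn lo by apply: nondecreasing_cvgn_le => //; exact: cvgP lo_cvg.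
have h2 : limn lo <= hi N.
  by apply: limr_le; [exact: cvgP lo_cvg|apply: nearW => n; exact: lohi].
by move: (limn lo) h1 h2 => l; rewrite /lo /hi => *; apply/andP; split; lra.
Qed.

Lemma invrX_le N a : (0 < a)%N -> N.+1%:R ^- a <= N.+1%:R^-1 :> R.
Proof.
move=> a0; rewrite lef_pV2 ?posrE ?exprn_gt0 ?ltr0n //.
by rewrite -{1}[N.+1%:R]expr1 ler_weXn2l // ler1n.
Qed.

Lemma mhs_le_lg s N : all (ltn 0%N) s -> mhs s N <= lg N ^+ size s.
Proof.
elim: s N => [|a s IH] N /=; first by rewrite expr0.
move=> /andP[a0 s0].
apply: (@le_trans _ _ (harm N * lg N ^+ size s)).
  rewrite big_distrl /=; apply: ler_sum => n _; rewrite mulr1.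
  apply: ler_pM; rewrite ?invr_ge0 ?exprn_ge0 ?mhs_ge0 ?invrX_le //.
  apply: le_trans (IH n s0) _; rewrite lerXn2r ?nnegrE ?(ltW (lg_gt0 _ _)) //.
  by apply: lg_ndecr; exact: ltnW.
by rewrite exprS ler_wpM2r ?harm_le_lg // exprn_ge0 // ltW // lg_gt0.
Qed.

(** As a >= 2, the N-th increment is at most lg^(size s) / (N + 1)^2. *)
Lemma mhs_cvg a s : (1 < a)%N -> all (ltn 0%N) s ->
  exists l : R, mhs (a :: s) @ \oo --> l /\
    exists D, forall N, `|mhs (a :: s) N - l| <= D * (lg N ^+ size s / N.+1%:R).
Proof.
move=> a1 s0; apply: (@cvg_of_lg_increments _ _ 1) => N.
rewrite mhsS addrAC subrr add0r mul1r ger0_norm; last first.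
  by rewrite mulr_ge0 ?mhs_ge0 // invr_ge0 exprn_ge0.
rewrite mulrC; apply: ler_pM; rewrite ?mhs_ge0 ?invr_ge0 ?exprn_ge0 ?mhs_le_lg //.
by rewrite lef_pV2 ?posrE ?exprn_gt0 ?ltr0n // ler_weXn2l // ler1n.
Qed.

End Convergence.

(** * Regular sequences *)

Section ExhaustedSums.
Variables (R : realType) (T : choiceType).

Lemma ler_sum_seq_sub (r s : seq T) (a : T -> R) (D : set T) :
  (forall x, D x -> 0 <= a x) -> uniq r -> uniq s ->
  {subset r <= s} -> {in s, forall x, D x} ->
  \sum_(x <- r) a x <= \sum_(x <- s) a x.
Proof.
move=> a0 ur us rs sD; rewrite [leRHS](bigID (mem r)) /=.
rewrite -[X in _ <= X + _]big_filter [X in _ <= X + _](perm_big r); last first.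
  apply: uniq_perm; rewrite ?filter_uniq // => x.
  by rewrite mem_filter; case: (boolP (x \in r)) => // /rs ->.
by rewrite lerDl big_seq_cond; apply: sumr_ge0 => x /andP[/sD/a0].
Qed.

(** Each r N is a finite subset of D, and each finite subset of D lies in r N for all large N; the
    two inequalities follow. This turns the unordered sums of the statement into limits of
    truncations. *)
Lemma esum_cvg (D : set T) (a : T -> R) (r : nat -> seq T) (l : R) :
  (forall x, D x -> 0 <= a x) -> (forall N, uniq (r N)) ->
  (forall N, {in r N, forall x, D x}) ->
  (forall x, D x -> exists N, forall M, (N <= M)%N -> x \in r M) ->
  (\sum_(x <- r N) a x) @[N --> \oo] --> l ->
  \esum_(x in D) (a x)%:E = l%:E.
Proof.
move=> a0 ur rD Dr al; apply/eqP; rewrite eq_le; apply/andP; split.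
  apply: ge_ereal_sup => _ /= [F [finF FD] <-]; rewrite fsbig_finite //= sumEFin.
  rewrite lee_fin -(cvg_lim _ al) //; apply: limr_ge; first exact: cvgP al.
  have [N HN] : exists N, forall M, (N <= M)%N -> {subset (fset_set F : seq T) <= r M}.
    have : {in (fset_set F : seq T), forall x, D x}.
      by move=> x; rewrite in_fset_set // => /set_mem/FD.
    elim: (fset_set F : seq T) => [|x s IH] sD; first by exists 0%N => M _ y; rewrite in_nil.
    have [N HN] : exists N, forall M, (N <= M)%N -> {subset s <= r M}.
      by apply: IH => y ys; apply: sD; rewrite inE ys orbT.
    have [M HM] := Dr x (sD x (mem_head _ _)).
    exists (maxn M N) => K; rewrite geq_max => /andP[MK NK] y.
    by rewrite inE => /orP[/eqP ->|/HN]; [exact: HM|exact].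
  exists N => // M /= /HN FM.
  by apply: ler_sum_seq_sub a0 (fset_uniq _) (ur M) FM (rD M).
have aE : (\sum_(x <- r N) a x)%:E @[N --> \oo] --> l%:E.
  by apply: cvg_EFin => //; apply: nearW.
rewrite -(cvg_lim _ aE) //; apply: lime_le; first exact: cvgP aE.
apply: nearW => N; apply: esum_ge; exists [set` r N].
  by split; [exact: finite_seq|move=> x; exact: rD].
by rewrite -fsbig_seq // sumEFin.
Qed.

End ExhaustedSums.

Section Regular.
Variable R : realType.
Implicit Types (u v : nat -> R) (x y : R).
Local Notation harm := (harm R).

Definition euler_algebra : set R := rat_combinations (finite_products
  (euler_sums_of_depth R 1 `|` euler_sums_of_depth R 2)).

(* Sequences with an asymptotic expansion [p(harm N) + logsmall], whose
   regularized value [p(0)] lies in [euler_algebra]; the other coefficients of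
   [p] are arbitrary reals. *)
Definition regular u := exists p : {poly R},
  euler_algebra p.[0] /\ logsmall (fun N : nat => u N - p.[harm N]).

Lemma euler_algebra0 : euler_algebra 0.
Proof. exact: rat_combinations0. Qed.

Lemma euler_algebraD x y :
  euler_algebra x -> euler_algebra y -> euler_algebra (x + y).
Proof. exact: rat_combinationsD. Qed.

Lemma euler_algebraZ (q : rat) x : euler_algebra x -> euler_algebra (ratr q * x).
Proof. exact: rat_combinationsZ. Qed.

Lemma euler_algebraM x y :
  euler_algebra x -> euler_algebra y -> euler_algebra (x * y).
Proof. by apply: rat_combinationsM; exact: finite_productsM. Qed.

Lemma eq_regular u v : u =1 v -> regular u -> regular v.
Proof.
move=> uv [p [p0 pu]]; exists p; split=> //.
by apply: eq_logsmall pu => N; rewrite uv.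
Qed.

Lemma logsmall_regular u : logsmall u -> regular u.
Proof.
move=> nu; exists 0; rewrite horner0; split; first exact: euler_algebra0.
by apply: eq_logsmall nu => N; rewrite horner0 subr0.
Qed.

Lemma regular0 : regular (fun=> 0).
Proof. exact/logsmall_regular/logsmall0. Qed.

Lemma regularD u v : regular u -> regular v -> regular (fun N => u N + v N).
Proof.
move=> [p [p0 pu]] [q [q0 qv]]; exists (p + q).
rewrite hornerD; split; first exact: euler_algebraD.
by apply: eq_logsmall (logsmallD pu qv) => N; rewrite hornerD; ring.
Qed.

Lemma regularZ (q : rat) u : regular u -> regular (fun N => ratr q * u N).
Proof.
move=> [p [p0 pu]]; exists ((ratr q)%:P * p).
rewrite hornerM hornerC; split; first exact: euler_algebraZ.
apply: eq_logsmall (logsmallM (polylog_cst (ratr q)) pu) => N.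
by rewrite hornerM hornerC mulrBr.
Qed.

Lemma regularM u v : regular u -> regular v -> regular (fun N => u N * v N).
Proof.
move=> [p [p0 pu]] [q [q0 qv]]; exists (p * q).
rewrite hornerM; split; first exact: euler_algebraM.
have n1 := logsmallM (polylog_horner p) qv.
have n2 := logsmallM (polylog_horner q) pu.
have n3 := logsmallM (logsmall_polylog pu) qv.
apply: eq_logsmall (logsmallD (logsmallD n1 n2) n3) => N.
by rewrite hornerM; ring.
Qed.

Lemma regular_int (z : int) u : regular u -> regular (fun N => z%:~R * u N).
Proof.
move=> /(regularZ z%:~R); apply: eq_regular => N.
by rewrite ratr_int.
Qed.

Lemma regularN u : regular u -> regular (fun N => - u N).
Proof. by move=> /(regular_int (-1)); apply: eq_regular => N; rewrite mulN1r. Qed.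

Lemma regularB u v : regular u -> regular v -> regular (fun N => u N - v N).
Proof. by move=> ru rv; apply: regularD ru (regularN rv). Qed.

Lemma regular_sum (I : Type) (r : seq I) (P : pred I) (F : I -> nat -> R) :
  (forall i, P i -> regular (F i)) -> regular (fun N => \sum_(i <- r | P i) F i N).
Proof.
move=> RF; elim: r => [|i r IH].
  by apply: eq_regular regular0 => N; rewrite big_nil.
case: (boolP (P i)) => Pi; last first.
  by apply: eq_regular IH => N; rewrite big_cons (negbTE Pi).
apply: eq_regular (regularD (RF i Pi) IH) => N; by rewrite big_cons Pi.
Qed.

Lemma regular_intK (z : int) u : z != 0 -> regular (fun N => z%:~R * u N) -> regular u.
Proof.
move=> z0 /(regularZ (z%:~R)^-1); apply: eq_regular => N.
by rewrite fmorphV /= ratr_int mulKf // intr_eq0.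
Qed.

Lemma regular_harm : regular harm.
Proof.
exists 'X; rewrite hornerX; split; first exact: euler_algebra0.
by apply: eq_logsmall (logsmall0 R) => N; rewrite hornerX subrr.
Qed.

Lemma regular_of_cvg u (l : R) :
  euler_algebra l -> logsmall (fun N => u N - l) -> regular u.
Proof.
move=> Al nu; exists l%:P; rewrite hornerC; split=> //.
by apply: eq_logsmall nu => N; rewrite hornerC.
Qed.

(** If u converges to l, then (p - l)(harm N) tends to 0, so p is the constant l by
    [horner_harm_cvg0] and l = p(0). *)
Lemma regular_lim u (l : R) : regular u -> u @ \oo --> l -> euler_algebra l.
Proof.
move=> [p [p0 pu]] ul.
suff /eqP : p - l%:P = 0 by rewrite subr_eq0 => /eqP pl; rewrite pl hornerC in p0.
apply: horner_harm_cvg0.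
rewrite (_ : (fun N => (p - l%:P).[harm N]) =
  (fun N => u N - (u N - p.[harm N]) - l)); last first.
  by apply/funext => N; rewrite !hornerE; ring.
rewrite -[X in _ --> X](subrr l) -[X in _ --> X - _](subr0 l).
exact: cvgB (cvgB ul (logsmall_cvg0 pu)) (cvg_cst l).
Qed.

End Regular.

(** * Regularity of truncated single and double sums *)

Section DepthTwo.
Variable R : realType.
Local Notation mhs := (mhs R).

Lemma sum_square (g : nat -> nat -> R) (N : nat) :
  \sum_(m < N) \sum_(n < N) g m n =
  \sum_(n < N) \sum_(m < n) (g n m + g m n) + \sum_(n < N) g n n.
Proof.
elim: N => [|N IH]; first by rewrite !big_ord0 addr0.
rewrite big_ord_recr /=; under eq_bigr do rewrite big_ord_recr /=.
rewrite big_split /= IH big_ord_recr /= [in RHS]big_ord_recr /=.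
rewrite [X in _ = _ + _ + X]big_ord_recr /= [in RHS]big_split /=; ring.
Qed.

Lemma mhs1_euler_sum (a : nat) (l : R) :
  (1 < a)%N -> mhs [:: a] @ \oo --> l -> euler_sums_of_depth R 1 l.
Proof.
move=> a1 al; exists [tuple a]; first by rewrite /admissible /= a1 (ltnW a1).
pose r N : seq (1.-tuple nat) := [seq [tuple n.+1] | n <- index_iota 0 N].
apply: (@esum_cvg _ _ _ _ r) => [n _|N|N n|n|].
- by apply: prodr_ge0 => j _; rewrite invr_ge0 exprn_ge0.
- rewrite map_inj_uniq ?iota_uniq // => i j /(congr1 (fun t => thead t)).
  by rewrite /thead !(tnth_nth 0%N) /= => -[].
- by case/mapP=> i _ -> /=.
- case/tupleP: n => x n; rewrite [n]tuple0 /= => /andP[x0 _]; exists x => M xM.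
  apply/mapP; exists x.-1; first by rewrite mem_index_iota /= prednK.
  by apply: val_inj; rewrite /= prednK.
rewrite (_ : (fun N => _) = mhs [:: a]) //; apply/funext => N.
rewrite big_map big_mkord; apply: eq_bigr => n _.
by rewrite big_ord_recl big_ord0 !(tnth_nth 0%N).
Qed.

Lemma mhs2_euler_sum (a b : nat) (l : R) :
  (1 < a)%N -> (0 < b)%N -> mhs [:: a; b] @ \oo --> l -> euler_sums_of_depth R 2 l.
Proof.
move=> a1 b0 abl; exists [tuple a; b].
  by rewrite /admissible /= a1 b0 (ltnW a1).
pose r N : seq (2.-tuple nat) :=
  [seq [tuple n.+1; m.+1] | n <- index_iota 0 N, m <- index_iota 0 n].
apply: (@esum_cvg _ _ _ _ r) => [n _|N|N n|n|].
- by apply: prodr_ge0 => j _; rewrite invr_ge0 exprn_ge0.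
- apply: allpairs_uniq_dep; [exact: iota_uniq|by move=> *; exact: iota_uniq|].
  by move=> [i1 i2] [j1 j2] _ _ /= /(congr1 val) /= [-> ->].
- rewrite /r => /allpairsPdep[i [j [_ + ->]]] /=; rewrite mem_index_iota /= => ji.
  by rewrite /gtn /= ltnS ji.
- case/tupleP: n => x n; case/tupleP: n => y n; rewrite [n]tuple0 /=.
  rewrite !andbT => /and3P[yx x0 y0]; exists x => M xM.
  apply/allpairsPdep; exists x.-1, y.-1; rewrite !mem_index_iota; split.
  + by rewrite /= prednK.
  + by rewrite /= -ltnS !prednK.
  + by apply: val_inj; rewrite /= !prednK.
rewrite (_ : (fun N => _) = mhs [:: a; b]) //; apply/funext => N.
rewrite big_allpairs_dep big_mkord; apply: eq_bigr => n _ /=.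
rewrite big_mkord big_distrr; apply: eq_bigr => m _ /=.
by rewrite mulr1 !big_ord_recl big_ord0 !(tnth_nth 0%N) mulr1.
Qed.

Lemma euler_sum_algebra (l : R) : euler_sums_of_depth R 1 l \/ euler_sums_of_depth R 2 l ->
  euler_algebra l.
Proof. by move=> ?; apply/rat_combinations_sub/finite_products_sub. Qed.

Lemma logsmall_mhs a s (l : R) : (1 < a)%N -> all (ltn 0%N) s ->
  mhs (a :: s) @ \oo --> l -> logsmall (fun N => mhs (a :: s) N - l).
Proof.
move=> a1 s0 al; have [l' [al' [D HD]]] := mhs_cvg R a1 s0.
have -> : l = l' by exact: cvg_unique al al'.
apply: logsmall_le (logsmall_lg_over (size s) D) => N.
exact: le_trans (HD N) (ler_norm _).
Qed.

Lemma regular_mhs1 a : (0 < a)%N -> regular (mhs [:: a]).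
Proof.
case: a => [//|[_|a _]]; first exact: regular_harm.
have [l [al _]] := mhs_cvg R (isT : (1 < a.+2)%N) (isT : all (ltn 0%N) [::]).
apply: regular_of_cvg (logsmall_mhs _ _ al) => //.
by apply: euler_sum_algebra; left; exact: mhs1_euler_sum al.
Qed.

Lemma mhs_stuffle1 a b N :
  mhs [:: a] N * mhs [:: b] N =
  mhs [:: a; b] N + mhs [:: b; a] N + mhs [:: (a + b)%N] N.
Proof.
rewrite /= big_distrlr /= (sum_square (fun m n => m.+1%:R ^- a * 1 * (n.+1%:R ^- b * 1))).
congr (_ + _); last first.
  by apply: eq_bigr => n _; rewrite !mulr1 -invfM -exprD.
rewrite -big_split /=; apply: eq_bigr => n _.
rewrite big_split /= !big_distrr /=; congr (_ + _).
  by apply: eq_bigr => m _; rewrite !mulr1.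
by apply: eq_bigr => m _; rewrite !mulr1 mulrC.
Qed.

(** For a >= 2 the sum converges to a double Euler sum. For a = 1 < b the stuffle product reduces it
    to the convergent [mhs [:: b; 1]], and for a = b = 1 it gives twice the sum. *)
Lemma regular_mhs2 a b : (0 < a)%N -> (0 < b)%N -> regular (mhs [:: a; b]).
Proof.
have reg2 c d : (1 < c)%N -> (0 < d)%N -> regular (mhs [:: c; d]).
  move=> c1 d0; have d0' : all (ltn 0%N) [:: d] by rewrite /= d0.
  have [l [cl _]] := mhs_cvg R c1 d0'.
  apply: regular_of_cvg (logsmall_mhs c1 d0' cl).
  by apply: euler_sum_algebra; right; exact: mhs2_euler_sum cl.
move=> a0 b0; have [a1|a1] := ltnP 1%N a; first exact: reg2.
have st := regularB (regularM (regular_mhs1 a0) (regular_mhs1 b0))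
  (regular_mhs1 (ltn_addr b a0)).
have [b1|b1] := ltnP 1%N b.
  apply: eq_regular (regularB st (reg2 _ _ b1 a0)) => N.
  by rewrite mhs_stuffle1; ring.
have -> : a = 1%N by apply/eqP; rewrite eqn_leq a1.
have E : b = 1%N by apply/eqP; rewrite eqn_leq b1.
apply: (@regular_intK _ 2) => //; apply: eq_regular st => N.
have -> : a = 1%N by apply/eqP; rewrite eqn_leq a1.
by rewrite E mhs_stuffle1; ring.
Qed.

End DepthTwo.

(** * Products summed over a triangle *)

Section Triangles.
Variable R : realType.
Local Notation lg := (lg R).
Local Notation mhs := (mhs R).
Local Notation harm := (harm R).
Implicit Types (phi : nat -> nat -> R) (a b c N : nat).

Lemma sum_rev (psi : nat -> R) N : \sum_(l < N) psi (N - l)%N = \sum_(l < N) psi l.+1.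
Proof.
rewrite (reindex_inj rev_ord_inj); apply: eq_bigr => l _ /=.
by rewrite subKn.
Qed.

(** Both sides run over the pairs of positive integers p, q with p + q <= N: on the left along p + q
    = t + 1, on the right by p = m + 1. *)
Lemma sum_triangle phi N :
  \sum_(t < N) \sum_(l < t) phi (t - l)%N l.+1 =
  \sum_(m < N) \sum_(l < N.-1 - m) phi m.+1 l.+1.
Proof.
elim: N => [|N IH]; first by rewrite !big_ord0.
rewrite big_ord_recr /= IH [RHS]big_ord_recr /= subnn big_ord0 addr0.
have -> : \sum_(l < N) phi (N - l)%N l.+1 = \sum_(l < N) phi l.+1 (N - l)%N.
  rewrite (reindex_inj rev_ord_inj); apply: eq_bigr => l _ /=.
  by rewrite subKn // subnSK.
rewrite -big_split /=; apply: eq_bigr => m _.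
have -> : (N - m = (N.-1 - m).+1)%N by have := ltn_ord m; lia.
by rewrite big_ord_recr.
Qed.

Lemma sum_triangle_rev phi N :
  \sum_(n < N) \sum_(l < n) phi (N - n)%N l.+1 =
  \sum_(t < N) \sum_(l < t) phi (t - l)%N l.+1.
Proof.
rewrite sum_triangle (reindex_inj rev_ord_inj); apply: eq_bigr => m _ /=.
by rewrite subKn // (_ : N - m.+1 = N.-1 - m)%N //; lia.
Qed.

(** The last sum is the corner p + q > N of the square, where p = m + 1 and q = n + 1. *)
Lemma sum_square_triangle phi N :
  \sum_(m < N) \sum_(n < N) phi m.+1 n.+1 =
  \sum_(t < N) \sum_(l < t) phi (t - l)%N l.+1 +
  \sum_(m < N) \sum_(N.-1 - m <= n < N) phi m.+1 n.+1.
Proof.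
rewrite sum_triangle -big_split /=; apply: eq_bigr => m _.
rewrite -(big_mkord xpredT (fun n => phi m.+1 n.+1)).
rewrite (@big_cat_nat _ _ _ (N.-1 - m)) //=; last by lia.
by rewrite big_mkord.
Qed.

(* On the corner [m + n >= N], with [m, n >= 1], one has
   [1 / (m n) <= (1 / m + 1 / n) / (N + 1)], [n >= N + 1 - m] and
   [m >= N + 1 - n]; here the indices are shifted by one. *)
Lemma corner_term_le a b N m n : (0 < a)%N -> (0 < b)%N -> (2 < a + b)%N ->
  (m < N)%N -> (n < N)%N -> (N <= m + n + 1)%N ->
  m.+1%:R ^- a * n.+1%:R ^- b <=
  (m.+1%:R^-1 + (N - m)%:R^-1) * (n.+1%:R^-1 + (N - n)%:R^-1) / N.+1%:R :> R.
Proof.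
move=> a0 b0 ab mN nN Nmn.
have inv0 k : 0 <= k%:R^-1 :> R by rewrite invr_ge0.
have key (p q r : R) : 0 < p -> 0 < q -> 0 < r -> r <= p + q ->
    p^-1 * q^-1 <= (p^-1 + q^-1) / r.
  move=> p0 q0 r0 rpq; rewrite ler_pdivlMr // -subr_ge0.
  rewrite (_ : _ - _ = (p + q - r) / (p * q)); last by field; rewrite !gt_eqF.
  by rewrite divr_ge0 ?subr_ge0 ?mulr_ge0 // ltW.
have p0 : 0 < m.+1%:R :> R by rewrite ltr0n.
have q0 : 0 < n.+1%:R :> R by rewrite ltr0n.
have mn : m.+1%:R^-1 * n.+1%:R^-1 <= (m.+1%:R^-1 + n.+1%:R^-1) / N.+1%:R :> R.
  by apply: key; rewrite ?ltr0n // -natrD ler_nat; lia.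
have mle : m.+1%:R^-1 <= (N - n)%:R^-1 :> R.
  by rewrite lef_pV2 ?posrE ?ltr0n ?ler_nat; lia.
have nle : n.+1%:R^-1 <= (N - m)%:R^-1 :> R.
  by rewrite lef_pV2 ?posrE ?ltr0n ?ler_nat; lia.
have r0 := inv0 N.+1; have m1 := inv0 m.+1; have n1 := inv0 n.+1.
have Nm := inv0 (N - m)%N; have Nn := inv0 (N - n)%N.
have expand (p q r s : R) : 0 <= p -> 0 <= q -> 0 <= r -> p <= s ->
    p * (p + q) <= (p + r) * (q + s).
  move=> p1 q1 r1 ps; rewrite -subr_ge0.
  rewrite (_ : _ - _ = p * (s - p) + r * (q + s)); last by ring.
  have s1 := le_trans p1 ps.
  by apply: addr_ge0; apply: mulr_ge0; rewrite ?subr_ge0 ?addr_ge0.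
have pow e k : (0 < e)%N -> k.+1%:R ^- e.+1 <= k.+1%:R^-1 * k.+1%:R^-1 :> R.
  move=> e0; rewrite exprS invfM ler_pM // ?invr_ge0 ?exprn_ge0 //.
  exact: invrX_le.
(* One exponent is at least 2. That variable gives one reciprocal to [mn] and keeps a second one for
   [expand]. *)
have [a1|a1] := ltnP 1 a.
  have := pow a.-1 m; rewrite prednK // => /(_ (_ : 0 < a.-1)%N) Ha.
  have {}Ha : m.+1%:R ^- a <= m.+1%:R^-1 * m.+1%:R^-1 :> R by apply: Ha; lia.
  apply: (@le_trans _ _ (m.+1%:R^-1 * (m.+1%:R^-1 * n.+1%:R^-1))).
    by rewrite mulrA ler_pM ?invr_ge0 ?exprn_ge0 ?invrX_le.
  apply: (@le_trans _ _ (m.+1%:R^-1 * ((m.+1%:R^-1 + n.+1%:R^-1) / N.+1%:R))).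
    by rewrite ler_wpM2l.
  by rewrite mulrA ler_wpM2r //; exact: expand.
have := pow b.-1 n; rewrite prednK // => Hb.
have {}Hb : n.+1%:R ^- b <= n.+1%:R^-1 * n.+1%:R^-1 :> R by apply: Hb; lia.
apply: (@le_trans _ _ ((m.+1%:R^-1 * n.+1%:R^-1) * n.+1%:R^-1)).
  by rewrite -mulrA ler_pM ?invr_ge0 ?exprn_ge0 ?invrX_le.
apply: (@le_trans _ _ ((m.+1%:R^-1 + n.+1%:R^-1) / N.+1%:R * n.+1%:R^-1)).
  by rewrite ler_wpM2r.
rewrite mulrAC ler_wpM2r // mulrC addrC [leRHS]mulrC; exact: expand.
Qed.

Lemma sum_corner_weights N :
  \sum_(m < N) \sum_(n < N) (m.+1%:R^-1 + (N - m)%:R^-1) *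
    (n.+1%:R^-1 + (N - n)%:R^-1) / N.+1%:R = 4 * (harm N ^+ 2 / N.+1%:R) :> R.
Proof.
have E : \sum_(m < N) (m.+1%:R^-1 + (N - m)%:R^-1) = 2 * harm N :> R.
  rewrite big_split /= (sum_rev (fun l => l%:R^-1)) mulr_natl mulr2n.
  by congr (_ + _); apply: eq_bigr => n _; rewrite mulr1.
under eq_bigr do rewrite -mulr_suml -mulr_sumr.
by rewrite -!mulr_suml E; ring.
Qed.

(** The majorant in [corner_term_le] has separated variables, so its sum over the whole square is 4
    harm^2 / (N + 1); the factor h costs only a power of [lg N]. *)
Lemma logsmall_corner a b (h : nat -> R) (k : nat) (C : R) :
  (0 < a)%N -> (0 < b)%N -> (2 < a + b)%N -> 0 <= C ->
  (forall n, `|h n| <= C * lg n ^+ k) ->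
  logsmall (fun N => \sum_(m < N) \sum_(N.-1 - m <= n < N)
    m.+1%:R ^- a * n.+1%:R ^- b * h n).
Proof.
move=> a0 b0 ab C0 hC.
apply: logsmall_le (logsmall_lg_over (k + 2) (C * 4)) => N.
have lgk0 j n : 0 <= lg n ^+ j by rewrite exprn_ge0 // ltW // lg_gt0.
rewrite [leRHS]ger0_norm; last by rewrite !mulr_ge0 ?invr_ge0.
apply: (@le_trans _ _ (C * lg N ^+ k * (4 * (harm N ^+ 2 / N.+1%:R)))); last first.
  rewrite exprD [leRHS](_ : _ = C * lg N ^+ k * (4 * (lg N ^+ 2 / N.+1%:R))); last by ring.
  rewrite ler_wpM2l ?mulr_ge0 // ler_wpM2l // ler_wpM2r ?invr_ge0 //.
  by rewrite lerXn2r ?nnegrE ?mhs_ge0 ?harm_le_lg // ltW // lg_gt0.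
rewrite -sum_corner_weights mulr_sumr; apply: le_trans (ler_norm_sum _ _ _) _.
apply: ler_sum => m _; apply: le_trans (ler_norm_sum _ _ _) _.
rewrite mulr_sumr -(big_mkord xpredT (fun n => C * lg N ^+ k *
  ((m.+1%:R^-1 + (N - m)%:R^-1) * (n.+1%:R^-1 + (N - n)%:R^-1) / N.+1%:R))).
rewrite [leRHS](@big_cat_nat _ _ _ (N.-1 - m)) //=; last by have := ltn_ord m; lia.
apply: ler_wpDl.
  by apply: sumr_ge0 => n _; rewrite !(mulr_ge0, addr_ge0, invr_ge0).
rewrite big_seq [leRHS]big_seq; apply: ler_sum => n; rewrite mem_index_iota => /andP[n1 nN].
rewrite normrM mulrC; apply: ler_pM => //.
  apply: le_trans (hC n) _; rewrite ler_wpM2l // lerXn2r ?nnegrE ?(ltW (lg_gt0 _ _)) //.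
  by apply: lg_ndecr; exact: ltnW.
rewrite ger0_norm ?mulr_ge0 ?invr_ge0 ?exprn_ge0 //.
by apply: corner_term_le => //; have := ltn_ord m; lia.
Qed.

(** On the line p + q = t + 1 one has 1 / (p q) = (1 / p + 1 / q) / (t + 1), and both terms
    contribute equally. *)
Lemma mhs_triangle11 N :
  \sum_(t < N) \sum_(l < t) (t - l)%:R^-1 * l.+1%:R^-1 = 2 * mhs [:: 1%N; 1%N] N :> R.
Proof.
rewrite mulr_sumr; apply: eq_bigr => t _.
have -> : \sum_(l < t) (t - l)%:R^-1 * l.+1%:R^-1 =
    \sum_(l < t) t.+1%:R^-1 * ((t - l)%:R^-1 + l.+1%:R^-1) :> R.
  apply: eq_bigr => l _; have -> : t.+1%:R = (t - l)%:R + l.+1%:R :> R.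
    by rewrite -natrD; congr _%:R; have := ltn_ord l; lia.
  have : 0 < (t - l)%:R :> R by rewrite ltr0n subn_gt0.
  have : 0 < l.+1%:R :> R by rewrite ltr0n.
  by move: (_%:R) (_%:R) => x y *; field; rewrite !gt_eqF ?addr_gt0.
rewrite -mulr_sumr big_split /= (sum_rev (fun l => l%:R^-1)).
rewrite [RHS]mulrCA; congr (_ * _); rewrite mulr_natl mulr2n.
by congr (_ + _); apply: eq_bigr => l _; rewrite mulr1.
Qed.

(** The product of [mhs [:: a]] and [mhs [:: b; c]] cut off at p + n_1 <= N, where p = t - n and n_1
    = n + 1. This cut-off suits partial fractions, whose new outer index is p + n_1. *)
Definition mhs_triangle a b c N : R :=
  \sum_(t < N) \sum_(n < t) (t - n)%:R ^- a * n.+1%:R ^- b * mhs [:: c] n.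

Lemma mhs_triangleE a b c N : mhs_triangle a b c N = mhs [:: a] N * mhs [:: b; c] N -
  \sum_(m < N) \sum_(N.-1 - m <= n < N) m.+1%:R ^- a * n.+1%:R ^- b * mhs [:: c] n.
Proof.
have := sum_square_triangle (fun q r => q%:R ^- a * r%:R ^- b * mhs [:: c] r.-1) N.
move=> /(canLR (addrK _)) E; apply: etrans (esym E) _; congr (_ - _).
rewrite [in RHS]/mhs -/mhs big_distrlr /=.
by apply: eq_bigr => m _; apply: eq_bigr => n _; rewrite mulr1 mulrA.
Qed.

(* The exceptional case [a = b = 1]: the corner sum of [1 / (m n)] is exactly
   [mhs [:: 2]], so that the remainder tends to [zeta 2 * zeta c]. *)
Lemma regular_corner11 c : (1 < c)%N ->
  regular (fun N => \sum_(m < N) \sum_(N.-1 - m <= n < N)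
    m.+1%:R ^- 1 * n.+1%:R ^- 1 * mhs [:: c] n).
Proof.
move=> c1; have [l [cl [D HD]]] := mhs_cvg R c1 (isT : all (ltn 0%N) [::]).
have D0 : 0 <= D.
  have := HD 0%N; rewrite expr0 mul1r invr1 mulr1; exact: le_trans.
have Al : euler_algebra l.
  by apply: euler_sum_algebra; left; exact: mhs1_euler_sum cl.
have regl : regular (fun=> l).
  apply: regular_of_cvg Al _.
  by apply: eq_logsmall (logsmall0 R) => N; rewrite subrr.
(* By the rate of convergence [e] is bounded. Replacing [mhs [:: c] n] by [l] thus leaves a corner
   sum with exponents 1 and 2, which is [logsmall]. *)
pose e n := n.+1%:R * (mhs [:: c] n - l).
have He n : `|e n| <= D * lg n ^+ 0.
  rewrite /e normrM ger0_norm // mulrC -ler_pdivlMr ?ltr0n //.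
  by have := HD n; rewrite mulrA.
have ns := logsmall_corner (isT : (0 < 1)%N) (isT : (0 < 2)%N) isT D0 He.
apply: eq_regular (regularD (regularM regl (regular_mhs1 R (isT : (0 < 2)%N)))
  (logsmall_regular ns)) => N.
(* The square of [harm N] is 2 [mhs [:: 1; 1]] + [mhs [:: 2]] by stuffle, and its triangle part is
   already 2 [mhs [:: 1; 1]]. *)
have E : mhs [:: 2] N = \sum_(m < N) \sum_(N.-1 - m <= n < N) m.+1%:R^-1 * n.+1%:R^-1.
  have := sum_square_triangle (fun q r => q%:R^-1 * r%:R^-1) N.
  rewrite -big_distrlr /= mhs_triangle11.
  have -> : \sum_(i < N) i.+1%:R^-1 = harm N.
    by apply: eq_bigr => i _; rewrite mulr1.
  rewrite mhs_stuffle1 => /eqP.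
  by rewrite mulr_natl mulr2n (inj_eq (addrI _)) => /eqP.
rewrite E mulr_sumr -big_split; apply: eq_bigr => m _.
rewrite mulr_sumr -big_split; apply: eq_bigr => n _.
rewrite /e !expr1; move: (mhs [:: c] n) => z /=; have : n.+1%:R != 0 :> R by rewrite pnatr_eq0.
have : m.+1%:R != 0 :> R by rewrite pnatr_eq0.
by move: (n.+1%:R) (m.+1%:R) => x y *; field; apply/andP.
Qed.

Lemma regular_mhs_triangle a b c : (0 < a)%N -> (0 < b)%N -> (0 < c)%N ->
  (3 < a + b + c)%N -> regular (mhs_triangle a b c).
Proof.
move=> a0 b0 c0 abc; apply: eq_regular (fun N => esym (mhs_triangleE a b c N)) _.
apply: regularB; first exact: regularM (regular_mhs1 R a0) (regular_mhs2 R b0 c0).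
(* Otherwise a = b = 1, and the weight forces c >= 2. *)
have [ab|ab] := ltnP 2 (a + b).
  apply: logsmall_regular; apply: (@logsmall_corner _ _ _ 1 1) => // n.
  by rewrite ger0_norm ?mhs_ge0 // mul1r; apply: mhs_le_lg; rewrite /= c0.
have -> : a = 1%N by lia.
have -> : b = 1%N by lia.
by apply: regular_corner11; lia.
Qed.

End Triangles.

(** * Double shuffle relations *)

Definition compositions3 (d : nat) : seq (nat * nat * nat) :=
  [seq (j, k, d - j - k)%N | j <- index_iota 0 d.+1, k <- index_iota 0 (d - j).+1].

Definition monomial3 (A : pzRingType) (x y z : A) (e : nat * nat * nat) : A :=
  x ^+ e.1.1 * y ^+ e.1.2 * z ^+ e.2.

Section GeneratingFunction.
Variable R : realType.
Local Notation mhs := (mhs R).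
Implicit Types (x y z : int) (q r s : nat) (d N : nat) (e : nat * nat * nat).

Definition mhs3 e N : R := mhs [:: e.1.1.+1; e.1.2.+1; e.2.+1] N.

Definition mhs3_gen d x y z N : R :=
  \sum_(e <- compositions3 d) (monomial3 x y z e)%:~R * mhs3 e N.

(* The expansion of [1 / (q - x t)] in powers of [t], up to degree [d]. *)
Definition geometric d q x : {poly R} :=
  \poly_(i < d.+1) (x%:~R ^+ i * q%:R ^- i.+1).

Definition recip3 e q r s : R := q%:R ^- e.1.1.+1 * (r%:R ^- e.1.2.+1 * s%:R ^- e.2.+1).

Lemma compositions3P d e : e \in compositions3 d -> (e.1.1 + e.1.2 + e.2 = d)%N.
Proof.
by move=> /allpairsPdep[j [k [+ + ->]]]; rewrite !mem_index_iota /= => ? ?; lia.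
Qed.

(** Reading the generating function as a coefficient of t^d lets one identity between rational
    functions of t handle all compositions of d at once. *)
Lemma coef_geometric3 d q r s x y z :
  (geometric d q x * geometric d r y * geometric d s z)`_d =
  \sum_(e <- compositions3 d) (monomial3 x y z e)%:~R * recip3 e q r s.
Proof.
rewrite big_allpairs_dep -mulrA coefM -(big_mkord xpredT (fun j =>
  (geometric d q x)`_j * (geometric d r y * geometric d s z)`_(d - j))).
rewrite big_seq [RHS]big_seq; apply: eq_bigr => j.
rewrite mem_index_iota /= => jd.
rewrite coefM -(big_mkord xpredT (fun k =>
  (geometric d r y)`_k * (geometric d s z)`_(d - j - k))).
rewrite big_distrr big_seq [RHS]big_seq; apply: eq_bigr => k.
rewrite mem_index_iota /= => kd.
have kd' : (k < d.+1)%N by apply: leq_trans kd _; rewrite ltnS leq_subr.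
have ld : (d - j - k < d.+1)%N by rewrite ltnS -subnDA leq_subr.
rewrite !coef_poly jd kd' ld /monomial3 /recip3 /= !rmorphM /= !rmorphXn /=.
by ring.
Qed.

(** The truncated series inverts q - x t modulo t^(d+1), a precision that suffices for the
    coefficient of t^d. *)
Lemma geometricE d q x : (0 < q)%N -> exists c : {poly R},
  geometric d q x * (q%:R - x%:~R%:P * 'X) = 1 - c * 'X^(d.+1).
Proof.
move=> q0; have qU : q%:R != 0 :> R by rewrite pnatr_eq0 -lt0n.
pose t : {poly R} := (x%:~R / q%:R)%:P * 'X.
have gE : geometric d q x = (q%:R^-1)%:P * \sum_(i < d.+1) t ^+ i.
  rewrite /geometric poly_def big_distrr /=; apply: eq_bigr => i _.
  have -> : t ^+ i = ((x%:~R / q%:R) ^+ i)%:P * 'X^i.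
    by rewrite /t exprMn rmorphXn.
  rewrite mulrA -polyCM -mul_polyC; congr (_%:P * _).
  by rewrite exprMn exprVn exprS invfM; ring.
exists ((x%:~R / q%:R) ^+ d.+1)%:P.
rewrite rmorphXn /= -exprMn -/t -[RHS]opprB subrX1 gE.
have -> : q%:R - x%:~R%:P * 'X = q%:R%:P * (1 - t) :> {poly R}.
  by rewrite -polyC_natr mulrBr mulr1 /t mulrA -polyCM [_ * (_ / _)]mulrCA divff // mulr1.
by rewrite mulrACA -polyCM mulVf // mul1r; ring.
Qed.

(* [1 / (a b) = (1 / a + 1 / b) / (a + b)] for [a = q - x t] and [b = r - y t]. *)
Lemma geometric_partial_fractions d q r x y (w : {poly R}) :
  (0 < q)%N -> (0 < r)%N ->
  (geometric d q x * geometric d r y * w)`_d =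
  (geometric d (q + r) (x + y) * geometric d q x * w)`_d +
  (geometric d (q + r) (x + y) * geometric d r y * w)`_d.
Proof.
move=> q0 r0; have [[c Hc] [c' Hc']] := (geometricE d x q0, geometricE d y r0).
have [c'' Hc''] := geometricE d (x + y) (ltn_addr r q0).
move: Hc Hc' Hc''; set u := geometric d q x; set v := geometric d r y.
set s := geometric d (q + r) _; set a := q%:R - _; set b := r%:R - _.
have -> : (q + r)%:R - (x + y)%:~R%:P * 'X = a + b :> {poly R}.
  by rewrite /a /b natrD rmorphD /= polyCD; ring.
move=> ua vb sab; rewrite -coefD.
(* For exact inverses u, v, s of a, b, a + b the correction would vanish. Here it is a multiple of
   t^(d+1), found by writing each defect as 1 - u a, 1 - v b and 1 - s (a + b). *)
have -> : u * v * w = s * u * w + s * v * w +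
    w * (c'' * u * v - s * v * c - s * u * c') * 'X^(d.+1).
  have E1 : c * 'X^(d.+1) = 1 - u * a by rewrite ua; ring.
  have E2 : c' * 'X^(d.+1) = 1 - v * b by rewrite vb; ring.
  have E3 : c'' * 'X^(d.+1) = 1 - s * (a + b) by rewrite sab; ring.
  transitivity (s * u * w + s * v * w + w * (u * v * (c'' * 'X^(d.+1)) -
    s * v * (c * 'X^(d.+1)) - s * u * (c' * 'X^(d.+1)))); last by ring.
  by rewrite E1 E2 E3; ring.
by rewrite [LHS]coefD coefMXn ltnSn addr0.
Qed.

Definition coef3 d x y z q r s : R :=
  (geometric d q x * geometric d r y * geometric d s z)`_d.

Lemma mhs3_genE d x y z N : mhs3_gen d x y z N =
  \sum_(n < N) \sum_(m < n) \sum_(l < m) coef3 d x y z n.+1 m.+1 l.+1.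
Proof.
transitivity (\sum_(n < N) \sum_(m < n) \sum_(l < m)
    \sum_(e <- compositions3 d) (monomial3 x y z e)%:~R * recip3 e n.+1 m.+1 l.+1).
  under [RHS]eq_bigr do under eq_bigr do rewrite exchange_big.
  under [RHS]eq_bigr do rewrite exchange_big.
  rewrite [RHS]exchange_big; apply: eq_bigr => e _ /=.
  rewrite /mhs3 /= mulr_sumr; apply: eq_bigr => n _.
  rewrite !mulr_sumr; apply: eq_bigr => m _.
  rewrite !mulr_sumr; apply: eq_bigr => l _.
  by rewrite mulr1.
apply: eq_bigr => n _; apply: eq_bigr => m _; apply: eq_bigr => l _.
by rewrite /coef3 coef_geometric3.
Qed.

Lemma regular_compositions d x y z (F : nat * nat * nat -> nat -> R) :
  (forall e, (e.1.1 + e.1.2 + e.2 = d)%N -> regular (F e)) ->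
  regular (fun N => \sum_(e <- compositions3 d) (monomial3 x y z e)%:~R * F e N).
Proof.
move=> RF; apply: eq_regular (regular_sum (compositions3 d)
  (P := mem (compositions3 d)) _) => [N|e /compositions3P ed].
  by rewrite -big_seq.
exact/regular_int/RF.
Qed.

(** In the product of a single sum over m and a double sum over n > l, the orders m > n > l, n > m >
    l and n > l > m give the three terms. The coincidences m = n and m = l give double sums, which
    are regular. *)
Lemma stuffle_relation d x y z : regular (fun N =>
  mhs3_gen d x y z N + mhs3_gen d y x z N + mhs3_gen d y z x N).
Proof.
pose diag1 e := mhs [:: (e.1.1.+1 + e.1.2.+1)%N; e.2.+1].
pose diag2 e := mhs [:: e.1.2.+1; (e.1.1.+1 + e.2.+1)%N].
pose prod e N := mhs [:: e.1.1.+1] N * mhs [:: e.1.2.+1; e.2.+1] N.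
have reg : regular (fun N => \sum_(e <- compositions3 d) (monomial3 x y z e)%:~R *
    (prod e N - diag1 e N - diag2 e N)).
  apply: (@regular_compositions d x y z (fun e N => prod e N - diag1 e N - diag2 e N)).
  move=> e _; apply: regularB; first apply: regularB.
  - exact: regularM (regular_mhs1 _ _) (regular_mhs2 _ _ _).
  - exact: regular_mhs2.
  - exact: regular_mhs2.
apply: eq_regular reg => N.
pose g m n : R := \sum_(l < n) coef3 d x y z m.+1 n.+1 l.+1.
have prodE : \sum_(e <- compositions3 d) (monomial3 x y z e)%:~R * prod e N =
    \sum_(m < N) \sum_(n < N) g m n.
  rewrite /g; under [RHS]eq_bigr do under eq_bigr do
    under eq_bigr do rewrite /coef3 coef_geometric3.
  under [RHS]eq_bigr do under eq_bigr do rewrite exchange_big.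
  under [RHS]eq_bigr do rewrite exchange_big.
  rewrite [RHS]exchange_big; apply: eq_bigr => e _ /=.
  rewrite /prod /= big_distrlr /= mulr_sumr; apply: eq_bigr => m _.
  rewrite !mulr_sumr; apply: eq_bigr => n _.
  rewrite !mulr_sumr; apply: eq_bigr => l _.
  by rewrite /recip3; ring.
have diag1E : \sum_(e <- compositions3 d) (monomial3 x y z e)%:~R * diag1 e N =
    \sum_(n < N) g n n.
  rewrite /g; under [RHS]eq_bigr do under eq_bigr do rewrite /coef3 coef_geometric3.
  under [RHS]eq_bigr do rewrite exchange_big.
  rewrite [RHS]exchange_big; apply: eq_bigr => e _ /=.
  rewrite /diag1 /= mulr_sumr; apply: eq_bigr => n _.
  rewrite !mulr_sumr; apply: eq_bigr => l _.
  by rewrite /recip3 exprD invfM; ring.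
have diag2E : \sum_(e <- compositions3 d) (monomial3 x y z e)%:~R * diag2 e N =
    \sum_(n < N) \sum_(m < n) coef3 d x y z m.+1 n.+1 m.+1.
  under [RHS]eq_bigr do under eq_bigr do rewrite /coef3 coef_geometric3.
  under [RHS]eq_bigr do rewrite exchange_big.
  rewrite [RHS]exchange_big; apply: eq_bigr => e _ /=.
  rewrite /diag2 /= mulr_sumr; apply: eq_bigr => n _.
  rewrite !mulr_sumr; apply: eq_bigr => l _.
  by rewrite /recip3 exprD invfM; ring.
transitivity (\sum_(m < N) \sum_(n < N) g m n - \sum_(n < N) g n n -
    \sum_(n < N) \sum_(m < n) coef3 d x y z m.+1 n.+1 m.+1).
  rewrite -prodE -diag1E -diag2E -!sumrB; apply: eq_bigr => e _; ring.
(* First m is compared with n, which also cancels the diagonal m = n; then, where m < n, it is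
   compared with l. *)
rewrite sum_square addrK -sumrB !mhs3_genE -!big_split /=.
apply: eq_bigr => n _.
rewrite big_split /= /g (sum_square (fun m l => coef3 d x y z m.+1 n.+1 l.+1)).
rewrite addrA addrK -!big_split /=; apply: eq_bigr => m _.
rewrite -addrA big_split /=; congr (_ + (_ + _)); apply: eq_bigr => l _.
  by rewrite /coef3 [X in X * _]mulrC.
by rewrite /coef3 -mulrA mulrC.
Qed.

(** Partial fractions are applied to [mhs_triangle] twice: to the pair p, n_1, then, in the term
    that keeps p, to the pair p, n_2. The condition on d makes the weight exceed 3, as
    [regular_mhs_triangle] requires. *)
Lemma shuffle_relation d x y z : (0 < d)%N -> regular (fun N =>
  mhs3_gen d (x + y) y z N + mhs3_gen d (x + y) (x + z) x N +
  mhs3_gen d (x + y) (x + z) z N).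
Proof.
move=> d0; have reg : regular (fun N => \sum_(e <- compositions3 d)
    (monomial3 x y z e)%:~R * mhs_triangle R e.1.1.+1 e.1.2.+1 e.2.+1 N).
  apply: (@regular_compositions d x y z
    (fun e => mhs_triangle R e.1.1.+1 e.1.2.+1 e.2.+1)) => e ed.
  by apply: regular_mhs_triangle => //; lia.
apply: eq_regular reg => N.
transitivity (\sum_(t < N) \sum_(n < t) \sum_(l < n)
    coef3 d x y z (t - n) n.+1 l.+1).
  under [RHS]eq_bigr do under eq_bigr do
    under eq_bigr do rewrite /coef3 coef_geometric3.
  under [RHS]eq_bigr do under eq_bigr do rewrite exchange_big.
  under [RHS]eq_bigr do rewrite exchange_big.
  rewrite [RHS]exchange_big; apply: eq_bigr => e _ /=.
  rewrite /mhs_triangle mulr_sumr; apply: eq_bigr => t _.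
  rewrite !mulr_sumr; apply: eq_bigr => n _.
  rewrite /= !mulr_sumr; apply: eq_bigr => l _.
  by rewrite /recip3; ring.
rewrite !mhs3_genE -!big_split /=; apply: eq_bigr => t _.
(* In this term n_1 survives only through t + 1 = p + n_1. The pairs p, n_2 fill the triangle p +
   n_2 <= t, which is resummed along p + n_2 = m + 1. *)
pose psi q r : R := (geometric d t.+1 (x + y) * geometric d q x * geometric d r z)`_d.
transitivity (\sum_(n < t) \sum_(l < n) psi (t - n)%N l.+1 +
    \sum_(n < t) \sum_(l < n) coef3 d (x + y) y z t.+1 n.+1 l.+1).
  rewrite -big_split /=; apply: eq_bigr => n _; rewrite -big_split /=.
  apply: eq_bigr => l _; rewrite /coef3 geometric_partial_fractions ?subn_gt0 //.
  by rewrite /psi (_ : t - n + n.+1 = t.+1)%N //; have := ltn_ord n; lia.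
rewrite sum_triangle_rev [LHS]addrC -!big_split /=; apply: eq_bigr => m _.
rewrite -addrA; congr (_ + _).
transitivity (\sum_(l < m) coef3 d (x + y) (x + z) x t.+1 m.+1 (m - l)%N +
    \sum_(l < m) coef3 d (x + y) (x + z) z t.+1 m.+1 l.+1).
  rewrite -big_split /=; apply: eq_bigr => l _; rewrite /psi /coef3.
  rewrite -mulrA [LHS](_ : _ = (geometric d (m - l) x * geometric d l.+1 z *
    geometric d t.+1 (x + y))`_d); last by rewrite mulrC.
  rewrite geometric_partial_fractions ?subn_gt0 //.
  rewrite (_ : m - l + l.+1 = m.+1)%N; last by have := ltn_ord l; lia.
  by congr (_ + _); rewrite mulrC mulrA.
by rewrite (sum_rev (fun l => coef3 d (x + y) (x + z) x t.+1 m.+1 l)).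
Qed.

End GeneratingFunction.

(** * Solving the relations *)

Section Parity.
Variable R : realType.
Implicit Types (x y z : int) (d : nat).
Local Notation f := (mhs3_gen R).

(** The stuffle relations at (x, y, z) and (z, y, x) share two terms. *)
Lemma mhs3_gen_rev d x y z : regular (fun N => f d x y z N - f d z y x N).
Proof.
apply: eq_regular (regularB (stuffle_relation R d x y z) (stuffle_relation R d z y x)) => N.
by ring.
Qed.

(** The shuffle relations at (x - y, y, z) and (z, x - z, x - y) share two terms. *)
Lemma mhs3_gen_dual d x y z : (0 < d)%N ->
  regular (fun N => f d x y z N - f d x (x - z) (x - y) N).
Proof.
move=> d0; apply: eq_regular (regularB (shuffle_relation R (x - y) y z d0)
  (shuffle_relation R z (x - z) (x - y) d0)) => N.
by rewrite subrK (addrC z) subrK (addrC (x - y)); ring.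
Qed.

(* In terms of F(t0, t1, t2, t3) = f(t1 - t0, t2 - t0, t3 - t0), a cyclic shift
   of the arguments amounts to a change of sign of all of them. *)
Lemma mhs3_gen_cyclic d x y z : (0 < d)%N ->
  regular (fun N => f d (- x) (- y) (- z) N - f d (y - x) (z - x) (- x) N).
Proof.
move=> d0; apply: eq_regular (regularD (mhs3_gen_dual (- x) (- y) (- z) d0)
  (mhs3_gen_rev d (- x) (z - x) (y - x))) => N.
by rewrite !opprK (addrC (- x) z) (addrC (- x) y) addrA subrK.
Qed.

(** Cyclic shifts and a reversal carry the terms of the stuffle relation at (x - y, z - y, -y) to
    f(-y, -x, -z), f(-x, -z, -y) and, after two shifts, f(x, y, z). The first two also occur in the
    stuffle relation at (-y, -x, -z), whose remaining term is f(-x, -y, -z). *)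
Lemma mhs3_gen_opp d x y z : (0 < d)%N ->
  regular (fun N => f d x y z N - f d (- x) (- y) (- z) N).
Proof.
move=> d0.
have s1 := stuffle_relation R d (x - y) (z - y) (- y).
have s2 := stuffle_relation R d (- y) (- x) (- z).
have r1 := mhs3_gen_rev d (- y) (- z) (- x).
have c1 := mhs3_gen_cyclic y x z d0.
have c2 := mhs3_gen_cyclic y z x d0.
have c3 := mhs3_gen_cyclic (y - x) (z - x) (- x) d0.
have c4 := mhs3_gen_cyclic (- x) (- y) (- z) d0.
apply: eq_regular (regularB (regularD (regularD s1 c1)
  (regularD (regularB c2 r1) (regularD c3 c4))) s2) => N.
have -> : z - x - (y - x) = z - y by ring.
have -> : - x - (y - x) = - y by ring.
have -> : - (y - x) = x - y by ring.
have -> : - (z - x) = x - z by ring.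
have -> : - y - - x = x - y by ring.
have -> : - z - - x = x - z by ring.
by rewrite !opprK; ring.
Qed.

Lemma mhs3_genN d x y z N : f d (- x) (- y) (- z) N = (-1) ^+ d * f d x y z N.
Proof.
rewrite /mhs3_gen mulr_sumr big_seq [RHS]big_seq.
apply: eq_bigr => e /compositions3P <-; rewrite mulrA; congr (_ * _).
rewrite -[(-1) ^+ _](rmorph_sign (intmul 1)) -intrM; congr _%:~R.
rewrite /monomial3 (exprNn x) (exprNn y) (exprNn z) !exprD.
by move: ((-1) ^+ e.1.1) ((-1) ^+ e.1.2) ((-1) ^+ e.2) => *; ring.
Qed.

Lemma regular_mhs3_gen_odd d x y z : odd d -> regular (f d x y z).
Proof.
move=> od; have d0 : (0 < d)%N by case: (d) od.
apply: (@regular_intK R 2) => //; apply: eq_regular (mhs3_gen_opp x y z d0) => N.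
by rewrite mhs3_genN -signr_odd od expr1; ring.
Qed.

End Parity.

(** * Recovering the coefficients of the generating function *)

Section Interpolation.
Variable R : realType.

(* [2 ^ n P(x) - P(2 x)] has no term of degree [n]. *)
Lemma regular_interpolation n (u : nat -> nat -> R) :
  (forall x : int, regular (fun N => \sum_(i < n) x%:~R ^+ i * u i N)) ->
  forall i, (i < n)%N -> regular (u i).
Proof.
elim: n u => [//|n IH] u Hu.
have lower i : (i < n)%N -> regular (u i).
  move=> ni; apply: (@regular_intK R (2 ^+ n - 2 ^+ i)).
    by rewrite subr_eq0 (inj_eq (ieexprIn _ _)) // gtn_eqF.
  apply: (IH (fun i N => (2 ^+ n - 2 ^+ i : int)%:~R * u i N)) ni => x.
  apply: eq_regular (regularB (regular_int (2 ^+ n) (Hu x)) (Hu (2 * x))) => N.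
  rewrite big_ord_recr [X in _ - X]big_ord_recr /= mulrDr opprD addrACA.
  rewrite [X in _ + X](_ : _ = 0) ?addr0; last first.
    by rewrite intrM exprMn rmorphXn /=; ring.
  rewrite mulr_sumr -sumrB; apply: eq_bigr => j _.
  by rewrite rmorphB !rmorphXn intrM exprMn /=; ring.
(* The top coefficient is the value at x = 1 minus the lower coefficients. *)
move=> i; rewrite ltnS leq_eqVlt => /predU1P[->|]; last exact: lower.
apply: eq_regular (regularB (Hu 1) (regular_sum (index_enum 'I_n)
  (P := xpredT) (fun j _ => lower j (ltn_ord j)))) => N.
rewrite big_ord_recr /= (eq_bigr (fun j : 'I_n => u j N)).
  by rewrite addrAC subrr add0r expr1n mul1r.
by move=> j _; rewrite expr1n mul1r.
Qed.

(** By homogeneity z = 1 loses nothing; interpolation in x and then in y isolates each triple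
    sum. *)
Lemma regular_mhs3_of_gen d : (forall x y z, regular (mhs3_gen R d x y z)) ->
  forall e, (e.1.1 + e.1.2 + e.2 = d)%N -> regular (mhs3 R e).
Proof.
move=> reg [[j k] l] /= ed.
have H1 (y : int) i : (i < d.+1)%N -> regular (fun N =>
    \sum_(k < (d - i).+1) y%:~R ^+ k * mhs3 R (i, val k, d - i - k)%N N).
  apply: (regular_interpolation (u := fun i N =>
    \sum_(k < (d - i).+1) y%:~R ^+ k * mhs3 R (i, val k, d - i - k)%N N)) => x.
  apply: eq_regular (reg x y 1) => N.
  rewrite /mhs3_gen big_allpairs_dep big_mkord; apply: eq_bigr => m _.
  rewrite big_mkord mulr_sumr.
  apply: eq_bigr => p _; rewrite /monomial3 /= expr1n mulr1.
  by rewrite rmorphM !rmorphXn mulrA.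
have H2 i : (i < (d - j).+1)%N -> regular (mhs3 R (j, i, d - j - i)%N).
  apply: (regular_interpolation (u := fun i N => mhs3 R (j, i, d - j - i)%N N)).
  by move=> y; apply: H1; lia.
have -> : l = (d - j - k)%N by lia.
by apply: H2; lia.
Qed.

End Interpolation.

(** * Certified integer Gaussian elimination *)

Section Elimination.
Implicit Types (r p : seq Z) (rows : seq (seq Z)).

Definition eliminate p r : seq Z :=
  [seq head 0 p * a.2 - head 0 r * a.1 | a <- zip (behead p) (behead r)].

(* Removing the content keeps the coefficients small during the elimination. *)
Definition primitive_row r : seq Z :=
  let g := foldr Z.gcd 0 r in
  let s := [seq Z.div a g | a <- r] in
  if (g != 0) && ([seq g * a | a <- s] == r) then s else r.

(** Fraction-free elimination on binary integers, fit for [vm_compute]. The pivot row stays in the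
    list and is reduced to zero. *)
Fixpoint full_rank (n : nat) rows : bool :=
  if n is n'.+1 then
    if [seq r <- rows | head 0 r != 0] is p :: _
    then full_rank n' [seq primitive_row (eliminate p r) | r <- rows] else false
  else true.

Variable R : realType.
Implicit Types u : seq (nat -> R).

Definition combination r u (N : nat) : R :=
  \sum_(a <- zip r u) (int_of_Z a.1)%:~R * a.2 N.

Lemma combination_scale c r u N :
  combination [seq c * a | a <- r] u N = (int_of_Z c)%:~R * combination r u N.
Proof.
rewrite /combination; elim: r u => [|a r IH] [|v u] /=; rewrite ?big_nil ?mulr0 //.
by rewrite !big_cons IH mulrDr /= rmorphM intrM mulrA.
Qed.

Lemma combination_eliminate p r v u N :
  size p = (size u).+1 -> size r = (size u).+1 ->
  combination (eliminate p r) u N =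
  (int_of_Z (head 0 p))%:~R * combination r (v :: u) N -
  (int_of_Z (head 0 r))%:~R * combination p (v :: u) N.
Proof.
case: p r => [|a p] [|b r] //= [sp] [sr]; rewrite /combination /eliminate /= !big_cons /=.
suff -> : \sum_(c <- zip [seq a * c.2 - b * c.1 | c <- zip p r] u) (int_of_Z c.1)%:~R * c.2 N =
  (int_of_Z a)%:~R * (\sum_(c <- zip r u) (int_of_Z c.1)%:~R * c.2 N) -
  (int_of_Z b)%:~R * (\sum_(c <- zip p u) (int_of_Z c.1)%:~R * c.2 N) by ring.
elim: p r u sp sr => [|c p IH] [|e r] [|w u] //=; first by rewrite !big_nil !mulr0 subr0.
move=> [sp] [sr]; rewrite !big_cons IH //= rmorphB !rmorphM rmorphB !rmorphM /=; ring.
Qed.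

Lemma size_primitive_row r : size (primitive_row r) = size r.
Proof. by rewrite /primitive_row; case: ifP; rewrite ?size_map. Qed.

(** The equality test in [primitive_row] certifies that the division is exact, so the content is a
    nonzero integer factor that [regular_intK] removes. *)
Lemma regular_primitive_row r u :
  regular (combination r u) -> regular (combination (primitive_row r) u).
Proof.
rewrite /primitive_row; case: ifP => // /andP[g0 /eqP rE] ru.
apply: (@regular_intK R (int_of_Z (foldr Z.gcd 0 r))).
  by apply: contra g0 => /eqP/(congr1 Z_of_int); rewrite int_of_ZK => ->.
by apply: eq_regular ru => N; rewrite -combination_scale rE.
Qed.

Lemma full_rankP n rows u : full_rank n rows -> size u = n ->
  (forall r, r \in rows -> size r = n /\ regular (combination r u)) ->
  forall i, (i < n)%N -> regular (nth (fun=> 0) u i).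
Proof.
elim: n rows u => [//|n IH] rows [//|v u] /=.
case E : [seq r <- rows | head 0 r != 0] => [//|p s] fr [su] Hrows.
have : p \in [seq r <- rows | head 0 r != 0] by rewrite E mem_head.
rewrite mem_filter => /andP[p0 /Hrows[sp rp]].
have tail i : (i < n)%N -> regular (nth (fun=> 0) u i).
  move=> ni; apply: (IH _ _ fr su) ni => _ /mapP[r /Hrows[sr rr] ->]; rewrite size_primitive_row; split.
    by rewrite size_map size_zip !size_behead sp sr minnn.
  apply: regular_primitive_row; apply: eq_regular (regularB
    (regular_int (int_of_Z (head 0 p)) rr) (regular_int (int_of_Z (head 0 r)) rp)) => N.
  by rewrite (@combination_eliminate _ _ v) ?su.
case=> [_|i] /=; last by rewrite ltnS; exact: tail.
case: p p0 sp rp {E fr} => [//|a p] /= a0 [sp] rp.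
apply: (@regular_intK R (int_of_Z a)).
  by apply: contra a0 => /eqP/(congr1 Z_of_int); rewrite int_of_ZK => ->.
have rest : regular (combination p u).
  apply: eq_regular (regular_sum (index_enum 'I_n) (P := xpredT)
    (fun i _ => regular_int (int_of_Z (nth 0 p i)) (tail i (ltn_ord i)))) => N.
  rewrite /combination (big_nth (0, fun=> 0)) size_zip sp su minnn big_mkord.
  by apply: eq_bigr => i _; rewrite nth_zip ?sp ?su.
apply: eq_regular (regularB rp rest) => N.
by rewrite /combination /= big_cons addrK.
Qed.

End Elimination.

Section FullRank.
Implicit Types (x y z : Z).

Definition stuffle_row d x y z : seq Z :=
  [seq monomial3 x y z e + monomial3 y x z e + monomial3 y z x e
     | e <- compositions3 d].

Definition shuffle_row d x y z : seq Z :=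
  [seq monomial3 (x + y) y z e + monomial3 (x + y) (x + z) x e +
       monomial3 (x + y) (x + z) z e | e <- compositions3 d].

Definition relation_rows d (points : seq (Z * Z * Z)) : seq (seq Z) :=
  [seq stuffle_row d p.1.1 p.1.2 p.2 | p <- points] ++
  [seq shuffle_row d p.1.1 p.1.2 p.2 | p <- points].

(** These 64 points yield enough relations in degrees 2, 4 and 6, as the computation in
    [regular_mhs3] confirms. *)
Definition sample_points : seq (Z * Z * Z) :=
  let vals := [:: -1; 0; 1; 2] in
  [seq (q, z) | q <- [seq (x, y) | x <- vals, y <- vals], z <- vals].

Lemma int_of_ZD x y : int_of_Z (x + y) = int_of_Z x + int_of_Z y.
Proof. exact: rmorphD. Qed.

Lemma int_of_Z_monomial3 x y z e :
  int_of_Z (monomial3 x y z e) = monomial3 (int_of_Z x) (int_of_Z y) (int_of_Z z) e.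
Proof. by rewrite /monomial3 !rmorphM !rmorphXn. Qed.

Variable R : realType.

Lemma combination_map d (g : nat * nat * nat -> Z) N :
  combination [seq g e | e <- compositions3 d] [seq mhs3 R e | e <- compositions3 d] N =
  \sum_(e <- compositions3 d) (int_of_Z (g e))%:~R * mhs3 R e N.
Proof. by rewrite /combination zip_map big_map. Qed.

Lemma regular_mhs3_of_full_rank d : (0 < d)%N ->
  full_rank (size (compositions3 d)) (relation_rows d sample_points) ->
  forall e, (e.1.1 + e.1.2 + e.2 = d)%N -> regular (mhs3 R e).
Proof.
move=> d0 fr e ed; have e_in : e \in compositions3 d.
  apply/allpairsPdep; case: e ed => [[j k] l] /= <-; exists j, k.
  by rewrite !mem_index_iota; split; [lia|lia|congr (_, _); lia].
have reg := full_rankP fr (u := [seq mhs3 R e | e <- compositions3 d]) (size_map _ _).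
have : regular (nth (fun=> 0) [seq mhs3 R e | e <- compositions3 d]
                  (index e (compositions3 d))).
  apply: reg; last by rewrite index_mem.
  move=> r; rewrite mem_cat => /orP[] /mapP[p _ ->]; rewrite size_map; split=> //.
    apply: eq_regular (stuffle_relation R d (int_of_Z p.1.1) (int_of_Z p.1.2)
      (int_of_Z p.2)) => N.
    rewrite combination_map /mhs3_gen -!big_split /=; apply: eq_bigr => e' _.
    by rewrite !(int_of_ZD, int_of_Z_monomial3) !intrD !mulrDl.
  apply: eq_regular (shuffle_relation R (int_of_Z p.1.1) (int_of_Z p.1.2)
    (int_of_Z p.2) d0) => N.
  rewrite combination_map /mhs3_gen -!big_split /=; apply: eq_bigr => e' _.
  by rewrite !(int_of_ZD, int_of_Z_monomial3) !intrD !mulrDl.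
by rewrite (nth_map e) ?index_mem // nth_index.
Qed.

Lemma regular_mhs3 a b c : (0 < a)%N -> (0 < b)%N -> (0 < c)%N ->
  (3 < a + b + c)%N -> ~~ odd (a + b + c) \/ (a + b + c <= 10)%N ->
  regular (mhs R [:: a; b; c]).
Proof.
case: a b c => [|a] [|b] [|c] // _ _ _ w3 w.
pose d := (a + b + c)%N; suff : regular (mhs3 R (a, b, c)) by [].
(* The weight is d + 3: odd d is even weight, settled by parity, while even d leaves the weights 5,
   7 and 9. *)
have [od|ed] := boolP (odd d).
  by apply: (regular_mhs3_of_gen (d := d)) => // x y z; apply: regular_mhs3_gen_odd.
have d0 : (0 < d)%N by rewrite /d; lia.
have d8 : (d < 8)%N.
  case: w => [w|]; last by rewrite /d; lia.
  by exfalso; move: w ed; rewrite /d; lia.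
apply: (regular_mhs3_of_full_rank (d := d)) => //.
have : d \in [:: 2; 4; 6]%N by rewrite !inE; lia.
by rewrite !inE => /or3P[] /eqP ->; vm_compute.
Qed.

End FullRank.

(** * Reduction to triple Euler sums *)

Section WittenZeta.
Variable R : realType.
Implicit Types a b c d f N : nat.
Local Notation mhs := (mhs R).

(* The partial sums of [zeta_sl4 R a b c d 0 f], with [i + 1 = m1],
   [j + 1 = m1 + m2] and [k + 1 = m1 + m2 + m3]. *)
Definition sl4_sum a b c d f N : R :=
  \sum_(k < N) \sum_(j < k) \sum_(i < j) i.+1%:R ^- a * (j - i)%:R ^- b *
    (k - j)%:R ^- c * j.+1%:R ^- d * k.+1%:R ^- f.

(** Multiplication by (x + y) / z = 1. *)
Lemma partial_fraction_step (x y z : R) a b d : x != 0 -> y != 0 -> x + y = z -> z != 0 ->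
  x ^- a.+1 * y ^- b.+1 * z ^- d =
  x ^- a * y ^- b.+1 * z ^- d.+1 + x ^- a.+1 * y ^- b * z ^- d.+1.
Proof.
move=> x0 y0 <- z0; rewrite !exprS.
have := expf_neq0 a x0; have := expf_neq0 b y0; have := expf_neq0 d z0.
move: (x ^+ a) (y ^+ b) ((x + y) ^+ d) => u v w w0 v0 u0.
by field; rewrite x0 y0 z0 u0 v0 w0.
Qed.

Lemma sl4_sum_ab a b c d f N : sl4_sum a.+1 b.+1 c d f N =
  sl4_sum a b.+1 c d.+1 f N + sl4_sum a.+1 b c d.+1 f N.
Proof.
rewrite /sl4_sum -big_split; apply: eq_bigr => k _.
rewrite -big_split; apply: eq_bigr => j _.
rewrite -big_split; apply: eq_bigr => i _ /=.
have ij := ltn_ord i.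
have := @partial_fraction_step i.+1%:R (j - i)%:R j.+1%:R a b d.
rewrite !pnatr_eq0 -natrD subn_eq0 -ltnNge ij => /(_ isT isT _ isT) E.
have {}E := E (congr1 _ (_ : i.+1 + (j - i) = j.+1)%N).
have {}E := E (ltac:(lia)).
transitivity (i.+1%:R ^- a.+1 * (j - i)%:R ^- b.+1 * j.+1%:R ^- d *
  ((k - j)%:R ^- c * k.+1%:R ^- f) : R); first by ring.
by rewrite E; ring.
Qed.

Lemma sl4_sum_cd a b c d f N : sl4_sum a b c.+1 d.+1 f N =
  sl4_sum a b c d.+1 f.+1 N + sl4_sum a b c.+1 d f.+1 N.
Proof.
rewrite /sl4_sum -big_split; apply: eq_bigr => k _.
rewrite -big_split; apply: eq_bigr => j _.
rewrite -big_split; apply: eq_bigr => i _ /=.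
have jk := ltn_ord j.
have := @partial_fraction_step (k - j)%:R j.+1%:R k.+1%:R c d f.
rewrite !pnatr_eq0 -natrD subn_eq0 -ltnNge jk => /(_ isT isT _ isT) E.
have {}E := E (congr1 _ (_ : k - j + j.+1 = k.+1)%N).
have {}E := E (ltac:(lia)).
transitivity ((k - j)%:R ^- c.+1 * j.+1%:R ^- d.+1 * k.+1%:R ^- f *
  (i.+1%:R ^- a * (j - i)%:R ^- b) : R); first by ring.
by rewrite E; ring.
Qed.

Lemma sl4_sum_swap b c d f N : sl4_sum 0 b c d f N = sl4_sum b 0 c d f N.
Proof.
apply: eq_bigr => k _; apply: eq_bigr => j _.
apply: etrans _ (sum_rev (fun l => l%:R ^- b * 1^-1 * (k - j)%:R ^- c *
  j.+1%:R ^- d * k.+1%:R ^- f) j).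
by apply: eq_bigr => i _; rewrite expr0 invr1 mul1r mulr1.
Qed.

(** Exchanging m2 and m3 preserves m1 and m1 + m2 + m3, and m1 + m2 has exponent 0. *)
Lemma sl4_sum_rev a c f N : sl4_sum a 0 c 0 f N = sl4_sum a c 0 0 f N.
Proof.
apply: eq_bigr => k _.
have := sum_triangle_rev (fun q r => r%:R ^- a * q%:R ^- c * k.+1%:R ^- f : R) k.
have E x y z : x * 1^-1 * y * 1^-1 * z = x * y * z :> R by rewrite invr1 !mulr1.
have E' x y z : x * y * 1^-1 * 1^-1 * z = x * y * z :> R by rewrite invr1 !mulr1.
move=> H; transitivity (\sum_(n < k) \sum_(l < n) l.+1%:R ^- a * (k - n)%:R ^- c * k.+1%:R ^- f : R).
  by apply: eq_bigr => j _; apply: eq_bigr => i _; rewrite E.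
by rewrite H; apply: eq_bigr => j _; apply: eq_bigr => i _; rewrite E'.
Qed.

Lemma sl4_sum_mhs a d f N : sl4_sum a 0 0 d f N = mhs [:: f; d; a] N.
Proof.
apply: eq_bigr => k _; rewrite /= mulr_sumr; apply: eq_bigr => j _.
rewrite !mulr_sumr; apply: eq_bigr => i _.
by rewrite !expr0 invr1; ring.
Qed.

(** Convergence is carried along because [regular_lim] speaks of a given limit. *)
Definition tame (u : nat -> R) := regular u /\ exists l : R, u @ \oo --> l.

Lemma eq_tame u v : u =1 v -> tame u -> tame v.
Proof. by move=> /funext ->. Qed.

Lemma tameD u v : tame u -> tame v -> tame (fun N => u N + v N).
Proof.
move=> [ru [l ul]] [rv [m vm]]; split; first exact: regularD.
by exists (l + m); exact: cvgD.
Qed.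

Section FixedWeight.
Variable w : nat.
Hypothesis tame_mhs3 : forall a b c, (1 < a)%N -> (0 < b)%N -> (0 < c)%N ->
  (a + b + c = w)%N -> tame (mhs [:: a; b; c]).

(** Each step moves one unit from a or b to d, until a or b is 0 and a triple sum remains. Its
    middle exponent is positive: d starts positive or becomes so at the first step. *)
Lemma tame_sl4_sum_c0 a b d f : (1 < f)%N ->
  (0 < a)%N && (0 < b)%N || (0 < d)%N && (0 < a + b)%N ->
  (a + b + d + f = w)%N -> tame (sl4_sum a b 0 d f).
Proof.
move: {2}(a + b)%N (leqnn (a + b)) => n.
elim: n a b d => [|n IH] [|a] [|b] d //=; rewrite ?andbF // => abn f1 h abw.
- apply: eq_tame (fun N => esym (sl4_sum_swap _ _ _ _ N)) _.
  apply: eq_tame (fun N => esym (sl4_sum_mhs _ _ _ N)) _.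
  by apply: tame_mhs3 => //; lia.
- apply: eq_tame (fun N => esym (sl4_sum_mhs _ _ _ N)) _.
  by apply: tame_mhs3 => //; lia.
apply: eq_tame (fun N => esym (sl4_sum_ab _ _ _ _ _ N)) _.
by apply: tameD; apply: IH; lia.
Qed.

(** Each step moves one unit from c or d to f, so f >= 2 after the first one; this makes the final
    triple sums converge. *)
Lemma tame_sl4_sum_b0 a c d f : (0 < a)%N ->
  (0 < c)%N && (0 < d)%N && (0 < f)%N || (1 < f)%N && (0 < c + d)%N ->
  (a + c + d + f = w)%N -> tame (sl4_sum a 0 c d f).
Proof.
move=> a0; move: {2}(c + d)%N (leqnn (c + d)) => n.
elim: n c d f => [|n IH] [|c] [|d] f //=; rewrite ?andbF ?orbF // => cdn h acw.
- by apply: tame_sl4_sum_c0; lia.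
- apply: eq_tame (fun N => esym (sl4_sum_rev _ _ _ N)) _.
  by apply: tame_sl4_sum_c0; lia.
apply: eq_tame (fun N => esym (sl4_sum_cd _ _ _ _ _ N)) _.
by apply: tameD; apply: IH; lia.
Qed.

(** Partial fractions in m1, m2 remove one of a and b; those in m3, m1 + m2 then take over. *)
Lemma tame_sl4_sum a b c d f : (0 < a + b)%N -> (0 < c)%N -> (0 < d)%N -> (0 < f)%N ->
  (a + b + c + d + f = w)%N -> tame (sl4_sum a b c d f).
Proof.
move: {2}(a + b)%N (leqnn (a + b)) => n.
elim: n a b d => [|n IH] [|a] [|b] d // abn _ c0 d0 f0 abw.
- apply: eq_tame (fun N => esym (sl4_sum_swap _ _ _ _ N)) _.
  by apply: tame_sl4_sum_b0; lia.
- by apply: tame_sl4_sum_b0; lia.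
apply: eq_tame (fun N => esym (sl4_sum_ab _ _ _ _ _ N)) _.
by apply: tameD; apply: IH; lia.
Qed.

End FixedWeight.

Lemma zeta_sl4_lim a b c d f (l : R) :
  sl4_sum a b c d f @ \oo --> l -> zeta_sl4 R a b c d 0 f = l%:E.
Proof.
move=> sl; rewrite /zeta_sl4.
(* The triples with m1 + m2 + m3 <= N, parametrized by q = (m1 + m2 + m3 - 1, m1 + m2 - 1) and i =
   m1 - 1. *)
pose r N : seq (nat * nat * nat) :=
  [seq (i.+1, q.2 - i, q.1 - q.2)%N |
     q <- [seq (k, j) | k <- index_iota 0 N, j <- index_iota 0 k],
     i <- index_iota 0 q.2].
pose term (m : nat * nat * nat) : R := (m.1.1%:R ^+ a * m.1.2%:R ^+ b * m.2%:R ^+ c *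
  (m.1.1 + m.1.2)%N%:R ^+ d * (m.1.2 + m.2)%N%:R ^+ 0 *
  (m.1.1 + m.1.2 + m.2)%N%:R ^+ f)^-1.
rewrite (eq_esum (b := fun m => (term m)%:E)); last by move=> [[m1 m2] m3].
have mem_q N q : q \in [seq (k, j) | k <- index_iota 0 N, j <- index_iota 0 k] ->
    (q.2 < q.1 < N)%N.
  by move=> /allpairsPdep[k [j [+ + ->]]]; rewrite !mem_index_iota /= => -> ->.
apply: (@esum_cvg _ _ _ _ r) => [m _|N|N m|m|].
- by rewrite /term invr_ge0 !mulr_ge0 ?exprn_ge0.
- apply: allpairs_uniq_dep; [|by move=> *; exact: iota_uniq|].
    apply: allpairs_uniq_dep; [exact: iota_uniq|by move=> *; exact: iota_uniq|].
    by move=> [k j] [k' j'] _ _ /= [-> ->].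
  move=> p p' /allpairsPdep[[k j] [i [/mem_q /= kj + ->]]].
  move=> + /allpairsPdep[[k' j'] [i' [/mem_q /= kj' + ->]]] /=.
  rewrite !mem_index_iota /= => ij ij' [<- ji kji].
  have -> : k' = k by lia.
  by have -> : j' = j by lia.
- rewrite /r => /allpairsPdep[q [i [/mem_q + + ->]]]; rewrite mem_index_iota /=.
  by move=> ? ?; split; rewrite ?subn_gt0; lia.
- case: m => [[m1 m2] m3] /= [m10 m20 m30]; exists (m1 + m2 + m3)%N => M mM.
  apply/allpairsPdep; exists ((m1 + m2 + m3).-1, (m1 + m2).-1), m1.-1; split.
  + by apply/allpairsPdep; exists (m1 + m2 + m3).-1, (m1 + m2).-1;
      rewrite !mem_index_iota; split=> //; lia.
  + by rewrite mem_index_iota /=; lia.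
  + by congr (_, _, _); rewrite /=; lia.
rewrite (_ : (fun N => _) = sl4_sum a b c d f) //; apply/funext => N.
rewrite big_allpairs_dep big_allpairs_dep big_mkord; apply: eq_bigr => k _ /=.
rewrite big_mkord; apply: eq_bigr => j _ /=.
rewrite big_mkord; apply: eq_bigr => i _ /=.
have [ij jk] := (ltn_ord i, ltn_ord j).
rewrite /term /= (_ : i.+1 + (j - i) = j.+1)%N; last by lia.
rewrite (_ : j.+1 + (k - j) = k.+1)%N; last by lia.
by rewrite expr0 mulr1 !invfM.
Qed.

End WittenZeta.

Theorem theorem2p2 (R : realType) (a b c d f : nat)
    (ha : (0 < a)%N) (hb : (0 < b)%N) (hc : (0 < c)%N) (hd : (0 < d)%N)
    (hf : (0 < f)%N)
    (hw : ~~ odd (a + b + c + d + f) \/ (a + b + c + d + f <= 10)%N) :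
  exists2 x : R,
    rat_combinations
      (finite_products (euler_sums_of_depth R 1%N `|` euler_sums_of_depth R 2%N)) x
    & zeta_sl4 R a b c d 0%N f = x%:E.
Proof.
(* Five positive exponents give weight at least 5, above the bound 3 in [regular_mhs3]. *)
have tame_mhs3 a' b' c' : (1 < a')%N -> (0 < b')%N -> (0 < c')%N ->
    (a' + b' + c' = a + b + c + d + f)%N -> tame (mhs R [:: a'; b'; c']).
  move=> a1 b0 c0 E; split.
    by apply: regular_mhs3; rewrite ?E //; [exact: ltnW|lia].
  have [|l [al _]] := @mhs_cvg R a' [:: b'; c'] a1; first by rewrite /= b0 c0.
  by exists l.
have [reg [l sl]] : tame (sl4_sum R a b c d f).
  by apply: (tame_sl4_sum tame_mhs3) => //; rewrite addn_gt0 ha.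
exists l; first exact: regular_lim reg sl.
exact: zeta_sl4_lim.
Qed.
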